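(* Let $\Lambda$ be an artin algebra. Then $\Lambda$ is representation-finite if and only if there exists a positive integer $n$ such that $\Lambda$ is right $n$-Nakayama.
   Context: An artin algebra is an algebra $\Lambda$ over a commutative artinian ring $R$ that is finitely generated as an $R$-module. All modules are finitely generated right $\Lambda$-modules. $\Lambda$ is representation-finite if there are only finitely many isomorphism classes of indecomposable right $\Lambda$-modules. For a module $M$ put $\mathrm{rad}^0(M)=M$, $\mathrm{rad}^{i+1}(M)=\mathrm{rad}(\mathrm{rad}^i(M))$. A module is uniserial if it has a unique composition series (the zero module counts as uniserial). Let $M$ be a nonzero module of length $l$. $M$ is $1$-factor serial if it is uniserial; for $l\ge n>1$, $M$ is $n$-factor serial if $M/\mathrm{rad}^{l-n}(M)$ is uniserial and $M/\mathrm{rad}^{l-n+1}(M)$ is not uniserial. $\Lambda$ is right $n$-Nakayama if every indecomposable right $\Lambda$-module is $i$-factor serial for some $1\le i\le n$ and there exists at least one indecomposable $n$-factor serial right $\Lambda$-module. *)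

(* Defs.v *)
From HB Require Import structures.
From mathcomp Require Import all_boot all_algebra.
From mathcomp Require Import boolp classical_sets.

Set Implicit Arguments.
Unset Strict Implicit.
Unset Printing Implicit Defensive.

Import GRing.Theory.

Local Open Scope ring_scope.
Local Open Scope classical_set_scope.
Local Open Scope quotient_scope.

Section Submodules.
Variables (A : pzRingType) (V : lmodType A).

Record submodule : Type := Submodule {
  submod_set :> set V;
  submod_closedP : submod_closed [in submod_set] }.

Lemma submodule_eq (S T : submodule) : S = T :> set V -> S = T.
Proof.
case: S T => [S HS] [T HT] /= eST; rewrite -{}eST in HT *.
by congr Submodule; apply: Prop_irrelevance.
Qed.

Lemma mem_submodP (S : submodule) (x : V) :
  reflect (submod_set S x) (x \in [in submod_set S]).
Proof. by rewrite unfold_in; apply: asboolP. Qed.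

Lemma submod0 (S : submodule) : submod_set S 0.
Proof. by case: (submod_closedP S) => /mem_submodP. Qed.

Lemma submodDZ (S : submodule) a u v :
  submod_set S u -> submod_set S v -> submod_set S (a *: u + v).
Proof.
case: (submod_closedP S) => _ lS Su Sv; apply/mem_submodP.
by apply: lS; apply/mem_submodP.
Qed.

Lemma submod_closed_set (P : set V) :
  P 0 -> (forall a u v, P u -> P v -> P (a *: u + v)) -> submod_closed [in P].
Proof.
move=> P0 PDZ; split=> [|a u v]; rewrite !unfold_in; first exact/asboolP.
by move=> /asboolP Pu /asboolP Pv; apply/asboolP/PDZ.
Qed.

Lemma zero_submod_subproof : submod_closed [in [set (0 : V)]].
Proof. by apply: submod_closed_set => // a u v -> ->; rewrite scaler0 addr0. Qed.
Definition zero_submod : submodule := Submodule zero_submod_subproof.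

Lemma full_submod_subproof : submod_closed [in [set: V]].
Proof. exact: submod_closed_set. Qed.
Definition full_submod : submodule := Submodule full_submod_subproof.

Definition maximal_submod_of (N S : submodule) : Prop :=
  S `<` N /\ forall T : submodule, S `<=` T -> T `<=` N -> T = S \/ T = N.

Definition rad_set (N : submodule) : set V :=
  (N : set V) `&` \bigcap_(S in maximal_submod_of N) (S : set V).

Lemma rad_subproof (N : submodule) : submod_closed [in rad_set N].
Proof.
apply: submod_closed_set => [|a u v [Nu Mu] [Nv Mv]].
  by split=> [|S _]; apply: submod0.
by split=> [|S maxS]; apply: submodDZ => //; [apply: Mu | apply: Mv].
Qed.
Definition rad (N : submodule) : submodule := Submodule (rad_subproof N).

Definition rad_iter (i : nat) : submodule := iter i rad full_submod.

(* s = [:: N_1; ...; N_l] stands for the series 0 = N_0 < N_1 < ... < N_l = V; *)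
(* the initial term 0 is not listed, so that size s is the number of factors.  *)
Definition composition_series (s : seq submodule) : Prop :=
  last zero_submod s = full_submod /\
  forall i : nat, (i < size s)%N ->
    maximal_submod_of (nth zero_submod s i) (nth zero_submod (zero_submod :: s) i).

Definition has_length (l : nat) : Prop :=
  exists2 s, composition_series s & size s = l.

Definition uniserial : Prop := exists! s, composition_series s.

Definition nonzero_module : Prop := exists x : V, x != 0.

Definition indecomposable : Prop :=
  nonzero_module /\
  forall S T : submodule,
    (forall x : V, exists y z, [/\ submod_set S y, submod_set T z & x = y + z]) ->
    (S : set V) `&` T = [set 0] ->
    S = zero_submod \/ T = zero_submod.

Definition fin_gen : Prop :=
  exists (k : nat) (g : 'I_k -> V),
    forall x : V, exists c : 'I_k -> A, x = \sum_(i < k) c i *: g i.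

End Submodules.

Section QuotientModule.
Variables (A : pzRingType) (V : lmodType A) (N : submodule V).

Definition eqmod (x y : V) : bool := x - y \in [in submod_set N].

Lemma eqmodP x y : reflect (submod_set N (x - y)) (eqmod x y).
Proof. exact: mem_submodP. Qed.

Let NZ a x : submod_set N x -> submod_set N (a *: x).
Proof. by move=> Nx; rewrite -[_ *: _]addr0; apply/submodDZ/submod0. Qed.
Let ND x y : submod_set N x -> submod_set N y -> submod_set N (x + y).
Proof. by move=> Nx Ny; rewrite -[x]scale1r; apply: submodDZ. Qed.

Lemma eqmod_equiv : equiv_class_of eqmod.
Proof.
split=> [x | x y | y x z].
- by apply/eqmodP; rewrite subrr; apply: submod0.
- by apply/eqmodP/eqmodP => /(NZ (-1)); rewrite scaleN1r opprB.
- move=> /eqmodP Nxy /eqmodP Nyz; apply/eqmodP.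
  by rewrite -(subrKA y); apply: ND.
Qed.
Canonical eqmod_equiv_rel := EquivRelPack eqmod_equiv.
Canonical eqmod_encModRel := defaultEncModRel eqmod.

Definition quot_module : Type := {eq_quot eqmod}.
HB.instance Definition _ := Choice.on quot_module.
HB.instance Definition _ := EqQuotient.on quot_module.

Lemma quot_eqP x y : \pi_quot_module x = \pi_quot_module y <-> submod_set N (x - y).
Proof. by split=> [/eqquotP/eqmodP | ?]; last by apply/eqquotP/eqmodP. Qed.

Lemma repr_quotP x : submod_set N (repr (\pi_quot_module x) - x).
Proof. by apply/quot_eqP; rewrite reprK. Qed.

Definition quot_zero : quot_module :=
  \pi_quot_module 0.
Definition quot_add (x y : quot_module) : quot_module :=
  \pi_quot_module (repr x + repr y).
Definition quot_opp (x : quot_module) : quot_module :=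
  \pi_quot_module (- repr x).
Definition quot_scale a (x : quot_module) : quot_module :=
  \pi_quot_module (a *: repr x).

Lemma pi_quot_add x y :
  quot_add (\pi_quot_module x) (\pi_quot_module y) = \pi_quot_module (x + y).
Proof. by apply/quot_eqP; rewrite opprD addrACA; apply: ND; apply: repr_quotP. Qed.
Lemma pi_quot_opp x : quot_opp (\pi_quot_module x) = \pi_quot_module (- x).
Proof.
apply/quot_eqP; rewrite -opprD -[- (_ + _)]scaleN1r.
by apply: NZ; apply: repr_quotP.
Qed.
Lemma pi_quot_scale a x :
  quot_scale a (\pi_quot_module x) = \pi_quot_module (a *: x).
Proof. by apply/quot_eqP; rewrite -scalerBr; apply: NZ; apply: repr_quotP. Qed.

Lemma quot_addA : associative quot_add.
Proof.
elim/quotW=> x; elim/quotW=> y; elim/quotW=> z.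
by rewrite (pi_quot_add x y) (pi_quot_add y z)
  !(pi_quot_add _ (_ + _), pi_quot_add (_ + _)) addrA.
Qed.
Lemma quot_addC : commutative quot_add.
Proof.
by elim/quotW=> x; elim/quotW=> y; rewrite (pi_quot_add x y) (pi_quot_add y x) addrC.
Qed.
Lemma quot_add0 : left_id quot_zero quot_add.
Proof. by elim/quotW=> x; rewrite (pi_quot_add 0 x) add0r. Qed.
Lemma quot_addN : left_inverse quot_zero quot_opp quot_add.
Proof.
by elim/quotW=> x; rewrite (pi_quot_opp x) (pi_quot_add (- x) x) addNr.
Qed.
HB.instance Definition _ := GRing.isZmodule.Build quot_module
  quot_addA quot_addC quot_add0 quot_addN.

Lemma quot_scaleA a b x : quot_scale a (quot_scale b x) = quot_scale (a * b) x.
Proof.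
elim/quotW: x => x.
by rewrite (pi_quot_scale b x) (pi_quot_scale a) (pi_quot_scale _ x) scalerA.
Qed.
Lemma quot_scale1 : left_id 1 quot_scale.
Proof. by elim/quotW=> x; rewrite (pi_quot_scale 1 x) scale1r. Qed.
Lemma quot_scaleDr : right_distributive quot_scale +%R.
Proof.
move=> a; elim/quotW=> x; elim/quotW=> y.
rewrite (pi_quot_scale a x) (pi_quot_scale a y) [RHS]pi_quot_add -scalerDr.
by rewrite -pi_quot_scale; congr quot_scale; apply: pi_quot_add.
Qed.
Lemma quot_scaleDl x : {morph quot_scale^~ x : a b / a + b}.
Proof.
elim/quotW: x => x a b; rewrite (pi_quot_scale (a + b) x) (pi_quot_scale a x).
by rewrite (pi_quot_scale b x) [RHS]pi_quot_add scalerDl.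
Qed.
HB.instance Definition _ := GRing.Zmodule_isLmodule.Build A quot_module
  quot_scaleA quot_scale1 quot_scaleDr quot_scaleDl.

End QuotientModule.

Definition isomorphic (A : pzRingType) (M N : lmodType A) : Prop :=
  exists f : {linear M -> N}, bijective f.

Definition factor_serial (A : pzRingType) (n : nat) (M : lmodType A) : Prop :=
  nonzero_module M /\
  exists2 l : nat, has_length M l &
    (n = 1%N /\ uniserial M) \/
    [/\ (1 < n)%N, (n <= l)%N,
        uniserial (quot_module (rad_iter M (l - n))) &
        ~ uniserial (quot_module (rad_iter M (l - n + 1)))].

(* Since R is commutative, the submodules of the regular module R^o are the *)
(* ideals of R.                                                             *)
Definition artinian (R : comPzRingType) : Prop :=
  forall I : nat -> submodule R^o,
    (forall i, I i.+1 `<=` I i) ->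
    exists k, forall i, (k <= i)%N -> I i = I k.

Definition artin_algebra (R : comPzRingType) (L : algType R) : Prop :=
  artinian R /\ fin_gen L.

(* Right L-modules are modules over the converse ring L^c. *)
Definition representation_finite (L : pzRingType) : Prop :=
  exists (m : nat) (F : 'I_m -> lmodType L^c),
    forall M : lmodType L^c, fin_gen M -> indecomposable M ->
      exists i : 'I_m, isomorphic M (F i).

Definition right_Nakayama (L : pzRingType) (n : nat) : Prop :=
  (forall M : lmodType L^c, fin_gen M -> indecomposable M ->
     exists2 i : nat, (1 <= i <= n)%N & factor_serial i M) /\
  (exists M : lmodType L^c, [/\ fin_gen M, indecomposable M & factor_serial n M]).

(* Main.v *)
(** Every indecomposable module of an [n]-Nakayama algebra either has length at
    most [n] or has a unique maximal submodule, hence is cyclic and no longer than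
    the algebra itself; so the theorem amounts to the first Brauer-Thrall
    conjecture: bounded lengths of indecomposables imply finite representation
    type.

    That is proved without duality or the transpose. By Harada and Sai, a
    composite of [2 ^ b - 1] non-isomorphisms between indecomposables of length at
    most [b] vanishes. Hence, starting from a non-split monomorphism [X -> B] with
    cokernel [C], one can choose a maximal composite [Z -> C] of non-isomorphisms
    that does not lift to [B]; pulling back along it gives an almost split sequence
    starting at [X]. Left almost split maps then show that each indecomposable
    summand of the regular module maps nontrivially to finitely many
    indecomposables only, and these are all of them. *)
From HB Require Import structures.
Require Import Defs.
From mathcomp Require Import all_boot all_algebra.
From mathcomp Require Import boolp classical_sets.

Set Implicit Arguments.
Unset Strict Implicit.
Unset Printing Implicit Defensive.

Import GRing.Theory.

Local Open Scope ring_scope.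
Local Open Scope classical_set_scope.
Local Open Scope quotient_scope.

Identity Coercion set_to_pred : set >-> Funclass.

(** * Submodules, linear maps and length *)

Definition mk_submodule (A : pzRingType) (V : lmodType A) (P : set V) (P0 : P 0)
    (PDZ : forall a u v, P u -> P v -> P (a *: u + v)) : submodule V :=
  Submodule (submod_closed_set P0 PDZ).

Definition mk_linear (A : pzRingType) (U V : lmodType A) (f : U -> V)
    (fL : linear f) : {linear U -> V} :=
  HB.pack f (GRing.isLinear.Build A U V *:%R f fL).

Section SubmoduleOperations.
Variables (A : pzRingType).
Implicit Types U V W : lmodType A.

Section OneModule.
Variable V : lmodType A.
Implicit Types S T N : submodule V.

Lemma submodD S x y : S x -> S y -> S (x + y).
Proof. by move=> Sx Sy; rewrite -[x]scale1r; apply: submodDZ. Qed.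

Lemma submodZ S a x : S x -> S (a *: x).
Proof. by move=> Sx; rewrite -[_ *: _]addr0; apply/submodDZ/submod0. Qed.

Lemma submodN S x : S x -> S (- x).
Proof. by move=> Sx; rewrite -scaleN1r; apply: submodZ. Qed.

Lemma submodB S x y : S x -> S y -> S (x - y).
Proof. by move=> Sx Sy; apply: submodD => //; apply: submodN. Qed.

Lemma submod_sum S (I : Type) (r : seq I) (F : I -> V) :
  (forall i, S (F i)) -> S (\sum_(i <- r) F i).
Proof.
move=> SF; apply: (big_ind (submod_set S)) => [|x y|i _]; [exact: submod0| |exact: SF].
exact: submodD.
Qed.

Lemma submod_antisym S T : S `<=` T -> T `<=` S -> S = T.
Proof. by move=> sST sTS; apply/submodule_eq/seteqP. Qed.

Lemma submod_proper S T : S `<=` T -> S <> T -> S `<` T.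
Proof. by move=> sST neST; split=> // sTS; apply/neST/submod_antisym. Qed.

Lemma submod_properE S T : S `<` T -> S `<=` T /\ exists2 x, T x & ~ S x.
Proof. by move=> [sST /existsNP[x /not_implyP[Tx nSx]]]; split=> //; exists x. Qed.

Lemma capsub_subproof S T :
  (forall a u v, (S `&` T) u -> (S `&` T) v -> (S `&` T) (a *: u + v)).
Proof. by move=> a u v [? ?] [? ?]; split; apply: submodDZ. Qed.
Definition capsub S T : submodule V :=
  mk_submodule (conj (submod0 S) (submod0 T)) (@capsub_subproof S T).

Definition sumset S T : set V := [set z | exists x y, [/\ S x, T y & z = x + y]].
Lemma sumsub_subproof0 S T : sumset S T 0.
Proof. by exists 0, 0; rewrite addr0; split=> //; apply: submod0. Qed.
Lemma sumsub_subproof S T a u v :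
  sumset S T u -> sumset S T v -> sumset S T (a *: u + v).
Proof.
move=> [x [y [Sx Ty ->]]] [x' [y' [Sx' Ty' ->]]].
exists (a *: x + x'), (a *: y + y'); split; try exact: submodDZ.
by rewrite scalerDr addrACA.
Qed.
Definition sumsub S T : submodule V :=
  mk_submodule (sumsub_subproof0 S T) (@sumsub_subproof S T).

Lemma sumsubl S T : S `<=` sumsub S T.
Proof. by move=> x Sx; exists x, 0; rewrite addr0; split=> //; apply: submod0. Qed.

Lemma sumsubr S T : T `<=` sumsub S T.
Proof. by move=> x Tx; exists 0, x; rewrite add0r; split=> //; apply: submod0. Qed.

Lemma sumsub_min S T N : S `<=` N -> T `<=` N -> sumsub S T `<=` N.
Proof. by move=> sSN sTN _ [x [y [/sSN Nx /sTN Ny ->]]]; apply: submodD. Qed.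

Definition cycset (x : V) : set V := [set y | exists a : A, y = a *: x].
Lemma cycsub_subproof0 x : cycset x 0.
Proof. by exists 0; rewrite scale0r. Qed.
Lemma cycsub_subproof x a u v : cycset x u -> cycset x v -> cycset x (a *: u + v).
Proof. by move=> [b ->] [c ->]; exists (a * b + c); rewrite scalerDl scalerA. Qed.
Definition cycsub x : submodule V :=
  mk_submodule (cycsub_subproof0 x) (@cycsub_subproof x).

Lemma cycsub_id x : cycsub x x.
Proof. by exists 1; rewrite scale1r. Qed.

Lemma cycsub_min x S : S x -> cycsub x `<=` S.
Proof. by move=> Sx _ [a ->]; apply: submodZ. Qed.

Lemma zero_submod_min S : zero_submod V `<=` S.
Proof. by move=> _ ->; apply: submod0. Qed.

End OneModule.

Section LinearMap.
Variables (V W : lmodType A) (f : {linear V -> W}).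

Lemma imsub_subproof0 (S : submodule V) : (f @` S) 0.
Proof. by exists 0; [apply: submod0 | rewrite linear0]. Qed.
Lemma imsub_subproof (S : submodule V) a u v :
  (f @` S) u -> (f @` S) v -> (f @` S) (a *: u + v).
Proof.
move=> [x Sx <-] [y Sy <-]; exists (a *: x + y); first exact: submodDZ.
by rewrite linearP.
Qed.
Definition imsub (S : submodule V) : submodule W :=
  mk_submodule (imsub_subproof0 S) (@imsub_subproof S).

Lemma presub_subproof0 (T : submodule W) : (f @^-1` T) 0.
Proof. by rewrite /preimage /= linear0; apply: submod0. Qed.
Lemma presub_subproof (T : submodule W) a u v :
  (f @^-1` T) u -> (f @^-1` T) v -> (f @^-1` T) (a *: u + v).
Proof. by rewrite /preimage /= linearP; apply: submodDZ. Qed.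
Definition presub (T : submodule W) : submodule V :=
  mk_submodule (presub_subproof0 T) (@presub_subproof T).

Definition ker : submodule V := presub (zero_submod W).

Lemma imsubS (S T : submodule V) : S `<=` T -> imsub S `<=` imsub T.
Proof. by move=> sST _ [x /sST Tx <-]; exists x. Qed.

Lemma ker_inj : (forall x, f x = 0 -> x = 0) -> injective f.
Proof. by move=> f0 x y fxy; apply/subr0_eq/f0; rewrite linearB fxy subrr. Qed.

End LinearMap.
End SubmoduleOperations.

(** * Length bounds for submodules *)

Section Length.
Variables (A : pzRingType).
Implicit Types U V W : lmodType A.

(* [hle n S] says that S has length at most n. *)
Fixpoint hle V (n : nat) (S : submodule V) : Prop :=
  if n is m.+1 then forall T : submodule V, T `<` S -> hle m T
  else S `<=` [set 0].

Definition finlen V := exists n, hle n (full_submod V).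

Lemma hle_sub V n (S T : submodule V) : S `<=` T -> hle n T -> hle n S.
Proof.
case: n => [|n] sST; first exact: subset_trans.
by move=> hT U [sUS nSU]; apply: hT; split=> [|sTU]; [apply: subset_trans sST|
  apply/nSU/(subset_trans sST)].
Qed.

Lemma hleS V n (S : submodule V) : hle n S -> hle n.+1 S.
Proof. by move=> hS T [sTS _]; apply: hle_sub hS. Qed.

Lemma hleW V m n (S : submodule V) : (m <= n)%N -> hle m S -> hle n S.
Proof.
by move=> /subnK <-; elim: (n - m)%N => // k IHk /IHk; rewrite addSn; apply: hleS.
Qed.

Lemma hle_eq0 V n (S : submodule V) : S `<=` [set 0] -> hle n S.
Proof. by move=> S0; apply: (@hleW _ 0). Qed.

Lemma finlen_sub V (S : submodule V) : finlen V -> exists n, hle n S.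
Proof. by move=> [n hn]; exists n; apply: hle_sub hn. Qed.

Lemma hle_im V W (f : {linear V -> W}) n (S : submodule V) :
  hle n S -> hle n (imsub f S).
Proof.
elim: n S => [|n IHn] S hS; first by move=> _ [x /hS -> <-]; rewrite linear0.
move=> T /submod_properE[sTfS [_ [x Sx <-] nTx]].
have eT : T `<=` imsub f (capsub S (presub f T)).
  by move=> y Ty; have [z Sz zy] := sTfS y Ty; exists z => //; split=> //=; rewrite /preimage /= zy.
apply: hle_sub eT (IHn _ _); apply: hS; split=> [z []//|sS].
by case: (sS x Sx).
Qed.

(** A nonzero kernel element costs one unit of length. At the bottom, where [S] has length at most
    one, [S] is generated by [x] and its image vanishes. *)
Lemma hle_im_ker V W (f : {linear V -> W}) n (S : submodule V) x :
  S x -> x <> 0 -> f x = 0 -> hle n.+1 S -> hle n (imsub f S).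
Proof.
move=> + x0 fx0; elim: n S => [|n IHn] S Sx hS.
  case: (EM (cycsub x = S)) => [eS|neS].
    by move=> _ [y + <-]; rewrite -eS => -[a ->]; rewrite linearZ /= fx0 scaler0.
  have /hS /(_ x (cycsub_id x)) // : cycsub x `<` S.
  by apply: submod_proper neS; apply: cycsub_min.
move=> T /submod_properE[sTfS [_ [y Sy <-] nTy]].
have eT : T `<=` imsub f (capsub S (presub f T)).
  by move=> u Tu; have [z Sz zu] := sTfS u Tu; exists z => //; split=> //=; rewrite /preimage /= zu.
apply: hle_sub eT (IHn _ _ _).
  by split=> //=; rewrite /preimage /= fx0; apply: submod0.
by apply: hS; split=> [z []//|sS]; case: (sS y Sy).
Qed.

(** Induction on [m + n]: a proper submodule of [S] must have a smaller intersection with the kernel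
    or a smaller image, since one that keeps both is all of [S]. *)
Lemma hle_ext V W (f : {linear V -> W}) m n (S : submodule V) :
  hle m (capsub S (ker f)) -> hle n (imsub f S) -> hle (m + n) S.
Proof.
move: {2}(m + n)%N (erefl (m + n)%N) => p; elim: p m n S => [|p IHp] m n S.
  move=> /eqP; rewrite addn_eq0 => /andP[/eqP-> /eqP->] /= hK hI x Sx.
  by apply: hK; split=> //; apply: hI; exists x.
move=> emn hK hI; rewrite emn => T /submod_properE[sTS [x Sx nTx]].
have sK : capsub T (ker f) `<=` capsub S (ker f) by move=> y [/sTS].
have sI : imsub f T `<=` imsub f S by apply: imsubS.
case: (EM (capsub T (ker f) = capsub S (ker f))) => [eK|neK]; last first.
  case: m => [|m] in emn hK *; last first.
    rewrite -[p]/(p.+1.-1) -emn addSn; apply: IHp; first by case: emn.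
      exact/hK/submod_proper.
    exact: hle_sub hI.
  by case: neK; apply: submod_antisym => // y /hK ->; apply: submod0.
case: (EM (imsub f T = imsub f S)) => [eI|neI]; last first.
  case: n => [|n] in emn hI *; last first.
    rewrite -[p]/(p.+1.-1) -emn addnS; apply: IHp.
    - by move: emn; rewrite addnS => -[].
    - exact: hle_sub hK.
    - exact/hI/submod_proper.
  by case: neI; apply: submod_antisym => // y /hI ->; apply: submod0.
have [y Ty fyx] : imsub f T (f x) by rewrite eI; exists x.
case: nTx; rewrite -[x](subrK y); apply: submodD => //.
have [] // : capsub T (ker f) (x - y).
rewrite eK; split; first by apply: submodB => //; apply: sTS.
by rewrite /= /preimage /= linearB fyx subrr.
Qed.

Lemma hle_surj V W (f : {linear V -> W}) n : (forall y, exists x, f x = y) ->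
  hle n (full_submod V) -> hle n (full_submod W).
Proof.
by move=> fs hV; apply: hle_sub (hle_im f hV) => y _; have [x <-] := fs y; exists x.
Qed.

Lemma hle_inj V W (f : {linear V -> W}) n S : injective f ->
  hle n (imsub f S) -> hle n S.
Proof.
move=> fi; apply: (@hle_ext _ _ f 0) => x [_]; rewrite /= /preimage /= => fx.
by apply: fi; rewrite fx linear0.
Qed.

Lemma finlen_surj V W (f : {linear V -> W}) : (forall y, exists x, f x = y) ->
  finlen V -> finlen W.
Proof. by move=> fs [n hn]; exists n; apply: hle_surj hn. Qed.

Lemma finlen_inj V W (f : {linear V -> W}) : injective f -> finlen W -> finlen V.
Proof.
by move=> fi [n hn]; exists n; apply: (hle_inj fi); apply: hle_sub hn.
Qed.

Lemma fst_linear_subproof V W : linear (@fst V W). Proof. by []. Qed.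
Definition fst_lin V W : {linear (V * W)%type -> V} := mk_linear (@fst_linear_subproof V W).
Lemma snd_linear_subproof V W : linear (@snd V W). Proof. by []. Qed.
Definition snd_lin V W : {linear (V * W)%type -> W} := mk_linear (@snd_linear_subproof V W).
Lemma inl_linear_subproof V W : linear (fun x : V => (x, 0) : V * W).
Proof. by move=> a x y; congr pair; rewrite /= scaler0 addr0. Qed.
Definition inl_lin V W : {linear V -> (V * W)%type} := mk_linear (@inl_linear_subproof V W).
Lemma inr_linear_subproof V W : linear (fun y : W => (0, y) : V * W).
Proof. by move=> a x y; congr pair; rewrite /= scaler0 addr0. Qed.
Definition inr_lin V W : {linear W -> (V * W)%type} := mk_linear (@inr_linear_subproof V W).

Lemma finlen_prod V W : finlen V -> finlen W -> finlen (V * W)%type.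
Proof.
move=> [m hV] [n hW]; exists (m + n)%N; apply: (hle_ext (f := snd_lin V W)).
  apply: hle_sub (hle_im (inl_lin V W) hV) => -[x y] [_ /= y0]; exists x => //=.
  by rewrite -y0.
by apply: hle_sub hW.
Qed.

End Length.

(** * Construction of linear maps, quotients and submodules as modules *)

Section Maps.
Variables (A : pzRingType).
Implicit Types U V W : lmodType A.

(** Lifts, inverses and projections are specified by relations and extracted by choice, so they need
    no explicit formula. *)
Lemma linear_of_rel V W (R : V -> W -> Prop) :
  (forall x, exists y, R x y) ->
  (forall a x y x' y', R x x' -> R y y' -> R (a *: x + y) (a *: x' + y')) ->
  (forall x y y', R x y -> R x y' -> y = y') ->
  exists f : {linear V -> W}, forall x, R x (f x).
Proof.
move=> /choice[f Rf] RP Rfun.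
have fL : linear f by move=> a x y; apply: Rfun (Rf _) _; apply: RP.
by exists (mk_linear fL).
Qed.

Lemma lift_inj U V W (f : {linear V -> W}) (g : {linear U -> W}) :
  injective f -> (forall u, exists v, f v = g u) ->
  exists h : {linear U -> V}, forall u, f (h u) = g u.
Proof.
move=> fi fg; apply: (linear_of_rel (R := fun u v => f v = g u)) => //.
  by move=> a x y x' y' e e'; rewrite !linearP /= e e'.
by move=> x y y' <- /fi.
Qed.

Lemma lift_surj U V W (f : {linear V -> W}) (g : {linear V -> U}) :
  (forall w, exists v, f v = w) -> (forall v, f v = 0 -> g v = 0) ->
  exists h : {linear W -> U}, forall v, h (f v) = g v.
Proof.
move=> fs fg.
have gP v v' : f v = f v' -> g v = g v'.
  move=> e; apply/subr0_eq; rewrite -linearB; apply: fg.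
  by rewrite linearB e subrr.
have [|||h hP] := @linear_of_rel W U (fun w u => forall v, f v = w -> g v = u).
- by move=> w; have [v <-] := fs w; exists (g v) => v' /gP.
- move=> a x y x' y' e e' v fv.
  have [x0 fx0] := fs x; have [y0 fy0] := fs y.
  rewrite -(e _ fx0) -(e' _ fy0) -linearP; apply: gP.
  by rewrite linearP fx0 fy0 fv.
- by move=> w y y' e e'; have [v fv] := fs w; rewrite -(e _ fv) -(e' _ fv).
by exists h => v; rewrite (hP (f v) v).
Qed.

Lemma linear_inv V W (f : {linear V -> W}) : injective f ->
  (forall w, exists v, f v = w) ->
  exists g : {linear W -> V}, cancel f g /\ cancel g f.
Proof.
move=> fi fs; have [g gP] := @lift_inj _ _ _ f (idfun : {linear W -> W}) fi fs.
by exists g; split=> x; [apply: fi; rewrite gP | rewrite gP].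
Qed.

Section Quotient.
Variables (V : lmodType A) (N : submodule V).

Lemma quot_pi_linear : linear (\pi_(quot_module N) : V -> quot_module N).
Proof. by move=> a x y; symmetry; rewrite -pi_quot_add -pi_quot_scale. Qed.
Definition quot_pi : {linear V -> quot_module N} := mk_linear quot_pi_linear.

Lemma quot_pi_eq0 x : quot_pi x = 0 <-> N x.
Proof. by split=> [/quot_eqP|Nx]; [rewrite subr0 | apply/quot_eqP; rewrite subr0]. Qed.

Lemma quot_pi_surj q : exists x, quot_pi x = q.
Proof. by exists (repr q); apply: reprK. Qed.

Lemma finlen_quot : finlen V -> finlen (quot_module N).
Proof. exact: finlen_surj quot_pi_surj. Qed.

End Quotient.

Lemma hle_sum V m n (S T : submodule V) :
  hle m S -> hle n T -> hle (m + n) (sumsub S T).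
Proof.
move=> hS hT; apply: (@hle_ext _ _ _ (quot_pi S)).
  by apply: hle_sub hS => x [_ /quot_pi_eq0].
apply: hle_sub (hle_im (quot_pi S) hT) => _ [_ [x [y [Sx Ty ->]]] <-].
by exists y => //; rewrite linearD (iffRL (quot_pi_eq0 S x) Sx) add0r.
Qed.

Section SubmoduleType.
Variables (V : lmodType A) (S : submodule V).

(** A named predicate to which the closure instance can attach; this turns [S] itself into a
    module. *)
Definition mem_submod : {pred V} := [in submod_set S].
HB.instance Definition _ :=
  GRing.isSubmodClosed.Build A V mem_submod (submod_closedP S).

Record submod_type : predArgType :=
  SubmodElt { submod_val : V; _ : submod_val \in mem_submod }.
HB.instance Definition _ := [isSub for submod_val].
HB.instance Definition _ := [Choice of submod_type by <:].
HB.instance Definition _ := [SubChoice_isSubLmodule of submod_type by <:].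

Lemma submod_val_linear : linear submod_val. Proof. by []. Qed.
Definition submod_incl : {linear submod_type -> V} := mk_linear submod_val_linear.

Lemma submod_incl_inj : injective submod_incl.
Proof. exact: val_inj. Qed.

Lemma submod_inclP u : S (submod_incl u).
Proof. exact/mem_submodP/(valP u). Qed.

Lemma submod_incl_im x : S x -> exists u, submod_incl u = x.
Proof. by move=> /mem_submodP Sx; exists (SubmodElt Sx). Qed.

Lemma finlen_submod : finlen V -> finlen submod_type.
Proof. exact: finlen_inj submod_incl_inj. Qed.

Lemma hle_submod_type n : hle n S -> hle n (full_submod submod_type).
Proof.
move=> hS; apply: (hle_inj submod_incl_inj); apply: hle_sub hS => _ [u _ <-].
exact: submod_inclP.
Qed.

End SubmoduleType.

Lemma hle_proper V n (S T : submodule V) : S `<` T -> hle n T ->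
  exists2 m, n = m.+1 & hle m S.
Proof.
case: n => [|n] /[dup] ST [sST nTS] hT; last by exists n => //; apply: hT.
by case: nTS => x /hT ->; apply: submod0.
Qed.

Lemma ex_maximal_submod V n (S T : submodule V) : S `<` T -> hle n T ->
  exists2 M, maximal_submod_of T M & S `<=` M.
Proof.
(* Climbing from [S] towards [T] must stop: [k] is a lower bound for the length of [U], raised by
   each strict enlargement, and [j] is the room left below the bound for [T]. *)
suff H j k (U : submodule V) : S `<=` U -> U `<` T -> (forall p, hle p U -> (k <= p)%N) ->
    hle (k + j) T -> exists2 M, maximal_submod_of T M & S `<=` M.
  by move=> ST hT; apply: (H n 0 S).
elim: j k U => [|j IHj] k U sSU UT hU hT.
  have [m km /hU] := hle_proper UT hT.
  by rewrite addn0 in km; rewrite km ltnn.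
have [maxU|] := EM (maximal_submod_of T U); first by exists U.
move=> /not_andP[//|/existsNP[U' /not_implyP[sUU' /not_implyP[sU'T]]]].
move=> /not_orP[neU neT]; apply: (IHj k.+1 U'); last by rewrite addSnnS.
- exact: subset_trans sUU'.
- exact: submod_proper.
- move=> p hp; have UU' : U `<` U' by apply: submod_proper => // e; apply: neU.
  by have [m -> /hU] := hle_proper UU' hp.
Qed.

End Maps.

(** * Indecomposable modules *)

Section Indecomposable.
Variables (A : pzRingType).
Implicit Types U V W X Y Z : lmodType A.

Definition indec V := finlen V /\ indecomposable V.

Definition is_iso V W (f : V -> W) := injective f /\ forall w, exists v, f v = w.

Lemma is_iso_isomorphic V W (f : {linear V -> W}) : is_iso f -> isomorphic V W.
Proof.
by move=> [fi fs]; have [g [fK gK]] := linear_inv fi fs; exists f; exists g.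
Qed.

Lemma isomorphic_sym V W : isomorphic V W -> isomorphic W V.
Proof.
move=> [f [g fK gK]]; have fi := can_inj fK.
have [|h [hK Kh]] := linear_inv fi; first by move=> w; exists (g w).
by exists h; exists f.
Qed.

(** By [hle_im_ker], a nonzero kernel element would lower the length bound of [f S], which is [S];
    repetition brings the bound down to zero. *)
Lemma imsub_fix_inj V (f : {linear V -> V}) n (S : submodule V) :
  hle n S -> imsub f S = S -> forall x, S x -> f x = 0 -> x = 0.
Proof.
elim: n => [|n IHn] hS fS x Sx fx; first exact: hS.
apply: contrapT => x0; apply: (x0); apply: IHn => //; rewrite -fS.
exact: hle_im_ker Sx x0 fx hS.
Qed.

Lemma inj_endo_surj V (f : {linear V -> V}) : finlen V -> injective f ->
  forall w, exists v, f v = w.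
Proof.
move=> [n]; elim: n => [|n IHn] hV fi w.
  by exists 0; rewrite linear0 (hV w).
have [e|neV] := EM (imsub f (full_submod V) = full_submod V).
  have : imsub f (full_submod V) w by rewrite e.
  by move=> [v _ <-]; exists v.
have /hV /(hle_inj fi) hV' : imsub f (full_submod V) `<` full_submod V.
  exact: submod_proper.
exact: IHn.
Qed.

Lemma descending_stable V n (I : nat -> submodule V) : hle n (I 0%N) ->
  (forall k, I k.+1 `<=` I k) -> exists k, I k.+1 = I k.
Proof.
elim: n I => [|n IHn] I hI dI.
  by exists 0%N; apply: submod_antisym => // x /hI ->; apply: submod0.
have [e|ne] := EM (I 1%N = I 0%N); first by exists 0%N.
have [||k ek] := IHn (I \o S); last by exists k.+1.
  exact/hI/(submod_proper (dI 0%N) ne).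
by move=> k; apply: dI.
Qed.

(** Powers of [f] stay bundled as linear maps, so that [ker] and [imsub] apply to them. *)
Fixpoint lin_iter V (f : {linear V -> V}) k : {linear V -> V} :=
  if k is k'.+1 then (f \o lin_iter f k') : {linear V -> V} else idfun.

(** Fitting's lemma: once the images of the powers of [f] are stable, [V] is the direct sum of the
    image and the kernel of a power. If the image vanishes, [f] is nilpotent, which is used only in
    the form that it fixes no nonzero element. *)
Lemma indec_endo V (f : {linear V -> V}) : indec V ->
  injective f \/ forall x, f x = x -> x = 0.
Proof.
move=> [finV [_ indV]].
pose I k := iter k (imsub f) (full_submod V).
have dI k : I k.+1 `<=` I k by elim: k => [//|k IHk]; apply: imsubS.
have [n hn] := finV.
have [k ek] := descending_stable (I := I) hn dI.
have [m hIk] := finlen_sub (I k) finV.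
have fI x : I k x -> f x = 0 -> x = 0 := fun Ix fx => imsub_fix_inj hIk ek Ix fx.
have Iim j x : I (j + k)%N x <-> imsub (lin_iter f j) (I k) x.
  elim: j x => [|j IHj] x /=; first by split=> [|[y Iy <-]]; [exists x|].
  split=> [[y /IHj[z Iz <-] <-]|[y Iy <-]]; first by exists z.
  by exists (lin_iter f j y) => //; apply/IHj; exists y.
have Istab j : I (j + k)%N = I k by elim: j => //= j IHj; rewrite -/(I _) IHj.
have Iit j x : I j (lin_iter f j x).
  by elim: j => //= j IHj; exists (lin_iter f j x).
have inj j x : I k x -> lin_iter f j x = 0 -> x = 0.
  elim: j => [//|j IHj] Ix /= fx; apply: IHj => //; apply: fI => //.
  by rewrite -(Istab j); apply/Iim; exists x.
have [||I0|K0] := indV (I k) (ker (lin_iter f k)).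
- move=> x; have : I (k + k)%N (lin_iter f k x) by rewrite Istab; apply: Iit.
  move=> /Iim[y Iy fy]; exists y, (x - y); split=> //; last by rewrite addrC subrK.
  by rewrite /= /preimage /= linearB fy subrr.
- apply/seteqP; split=> x; first by move=> [Ix /(inj k x Ix)].
  by move=> ->; split; apply: submod0.
- right=> x fx; suff -> : x = lin_iter f k x.
    by have := Iit k x; rewrite I0.
  by elim: (k) => //= j <-.
- left; apply: ker_inj => x; apply: fI.
  have : I (k + k)%N (lin_iter f k x) by rewrite Istab; apply: Iit.
  move=> /Iim[y Iy fy]; suff -> : x = y by [].
  apply/subr0_eq; suff : ker (lin_iter f k) (x - y) by rewrite K0.
  by rewrite /= /preimage /= linearB fy subrr.
Qed.

(** This is locality of the endomorphism ring: an element killed by [g] is fixed by [f]. *)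
Lemma indec_local X (f g : {linear X -> X}) : indec X ->
  (forall x, f x + g x = x) -> injective f \/ injective g.
Proof.
move=> indX fg; have [|f1] := indec_endo f indX; first by left.
right; apply: ker_inj => x gx; apply: f1.
by rewrite -[RHS]fg gx addr0.
Qed.

Lemma indec_nz X : indec X -> exists x : X, x <> 0.
Proof. by move=> [_ [[x /eqP nx] _]]; exists x. Qed.

(** [Y] is the direct sum of the image of [f] and the kernel of [r], and the image is nonzero
    because [X] is. *)
Lemma retract_iso X Y (f : {linear X -> Y}) (r : {linear Y -> X}) :
  indec X -> indec Y -> cancel f r -> is_iso f /\ is_iso r.
Proof.
move=> /indec_nz[x0 nx0] [_ [_ indY]] fK.
have fi := can_inj fK.
have [||I0|K0] := indY (imsub f (full_submod X)) (ker r).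
- move=> y; exists (f (r y)), (y - f (r y)); split; last by rewrite addrC subrK.
    by exists (r y).
  by rewrite /= /preimage /= linearB fK subrr.
- apply/seteqP; split=> x; last by move=> ->; split; apply: submod0.
  by move=> [[y _ <-]]; rewrite /= /preimage /= fK => ->; rewrite linear0.
- case: nx0; apply: fi; rewrite linear0.
  have : imsub f (full_submod X) (f x0) by exists x0.
  by rewrite I0.
- have ri : injective r.
    by apply: ker_inj => y ry; have : ker r y by []; rewrite K0.
  split; split=> //; first by move=> y; exists (r y); apply: ri; rewrite fK.
  by move=> x; exists (f x).
Qed.

Lemma proj_of_sum V (S T : submodule V) :
  (forall x : V, exists y z, [/\ S y, T z & x = y + z]) ->
  (S : set V) `&` T = [set 0] ->
  exists p : {linear V -> submod_type S}, forall x, T (x - submod_incl S (p x)).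
Proof.
move=> sST dST.
have [|||p Pp] := @linear_of_rel _ V (submod_type S) (fun x u => T (x - submod_incl S u)).
- move=> x; have [y [z [/submod_incl_im[u uy] Tz ->]]] := sST x.
  by exists u; rewrite uy addrC addKr.
- move=> a x y x' y' Tx Ty; rewrite (linearP (submod_incl S)) opprD addrACA -scalerBr.
  exact: submodDZ.
- move=> x y y' Ty Ty'; apply: submod_incl_inj; apply/subr0_eq.
  have : (S : set V) `&` T `<=` [set 0] by rewrite dST.
  apply; split; first by apply: submodB; apply: submod_inclP.
  by have := submodB Ty' Ty; rewrite opprB addrC subrKA.
- by exists p.
Qed.

(* Orthogonality of the summands of a decomposition is never needed, hence not recorded. *)
Record summand V := Summand {
  summand_obj : lmodType A;
  summand_incl : {linear summand_obj -> V};
  summand_proj : {linear V -> summand_obj};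
  summand_indec : indec summand_obj }.

Definition decomposable V := exists l : seq (summand V),
  forall x, \sum_(s <- l) summand_incl s (summand_proj s x) = x.

Lemma decomposable_of_sum V U W (f : {linear U -> V}) (f' : {linear V -> U})
    (g : {linear W -> V}) (g' : {linear V -> W}) :
  (forall x, f (f' x) + g (g' x) = x) ->
  decomposable U -> decomposable W -> decomposable V.
Proof.
move=> fgE [l sumU] [l' sumW].
pose F (s : summand U) := Summand (f \o summand_incl s : {linear _ -> _})
  (summand_proj s \o f' : {linear _ -> _}) (summand_indec s).
pose G (s : summand W) := Summand (g \o summand_incl s : {linear _ -> _})
  (summand_proj s \o g' : {linear _ -> _}) (summand_indec s).
exists (map F l ++ map G l') => x; rewrite big_cat !big_map /= -[RHS]fgE.
by congr (_ + _); rewrite -linear_sum ?sumU ?sumW.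
Qed.

Lemma finlen_decomposable V : finlen V -> decomposable V.
Proof.
move=> [n]; elim: n V => [|n IHn] V hV.
  by exists [::] => x; rewrite big_nil (hV x).
have [indV|] := EM (indecomposable V).
  have finV : finlen V by exists n.+1.
  exists [:: Summand (idfun : {linear V -> V}) (idfun : {linear V -> V}) (conj finV indV)].
  by move=> x; rewrite big_seq1.
(* A module that is not indecomposable is either zero, hence of length at most [n], or the direct
   sum of two proper submodules. *)
move=> /not_andP[V0|].
  apply: IHn; apply: hle_eq0 => x _; apply: contrapT => /eqP nx.
  by case: V0; exists x.
move=> /existsNP[S /existsNP[T /not_implyP[sST /not_implyP[dST /not_orP[S0 T0]]]]].
have dTS : (T : set V) `&` S = [set 0] by rewrite setIC.
have sTS x : exists y z, [/\ T y, S z & x = y + z].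
  by have [y [z [Sy Tz ->]]] := sST x; exists z, y; rewrite addrC.
have [p Pp] := proj_of_sum sST dST; have [q Pq] := proj_of_sum sTS dTS.
have propS (P Q : submodule V) : (P : set V) `&` Q = [set 0] -> Q <> zero_submod V ->
    P `<` full_submod V.
  move=> dPQ Q0; split=> // sP; apply: Q0; apply: submod_antisym; last exact: zero_submod_min.
  by move=> x Qx; rewrite -[zero_submod V : set V]/[set 0] -dPQ; split=> //; apply: sP.
apply: (decomposable_of_sum (f := submod_incl S) (f' := p) (g := submod_incl T) (g' := q)).
- move=> x; apply/subr0_eq; have : (S : set V) `&` T `<=` [set 0] by rewrite dST.
  apply; split.
    rewrite -addrA addrC; apply: submodD; last exact: submod_inclP.
    by rewrite -opprB; apply: submodN.
  rewrite addrAC; apply: submodD; last exact: submod_inclP.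
  by have := submodN (Pp x); rewrite opprB.
- by apply/IHn/hle_submod_type/hV; apply: propS dST T0.
- by apply/IHn/hle_submod_type/hV; apply: propS dTS S0.
Qed.

End Indecomposable.

(** * The Harada-Sai lemma *)

Section HaradaSai.
Variable A : pzRingType.
Implicit Types B D E V W X Y Z : lmodType A.

(** The map starts with [n] non-isomorphisms onto indecomposable stages and ends with an arbitrary
    map. For [X] indecomposable these are single composites in the [n]-th power of the radical of
    the module category. *)
Fixpoint radp n X Y (f : {linear X -> Y}) : Prop :=
  if n is m.+1 then
    exists Z (g : {linear X -> Z}) (h : {linear Z -> Y}),
      [/\ indec Z, ~ is_iso g, radp m h & forall x, f x = h (g x)]
  else True.

Lemma radp_split p q X Y (f : {linear X -> Y}) : indec X -> radp (p + q) f ->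
  exists Z (k : {linear X -> Z}) (l : {linear Z -> Y}),
    [/\ indec Z, radp p k, radp q l & forall x, f x = l (k x)].
Proof.
elim: p X f => [|p IHp] X f indX /=; first by exists X, idfun, f.
move=> [Z [g [h [indZ ng /(IHp _ _ indZ)[Z' [k [l [indZ' kp lq hE]]]] fE]]]].
exists Z', (k \o g : {linear _ -> _}), l; split=> //; last by move=> x; rewrite fE hE.
by exists Z, g, k.
Qed.

Variables (b : nat) (hleb : forall X, indec X -> hle b (full_submod X)).

(* In the decomposition f = l g k below, if the image of f is not smaller than those of k and l,
   then V = im k (+) ker (l g) makes g injective and W = im (g k) (+) ker l makes g surjective. *)
Lemma harada_sai_im m X Y (f : {linear X -> Y}) : indec X -> radp (2 ^ m).-1 f ->
  hle (b - m) (imsub f (full_submod X)).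
Proof.
elim: m X Y f => [|m IHm] X Y f indX.
  by move=> _; rewrite subn0; apply/hle_im/hleb.
(* Two blocks of [2 ^ m - 1] non-isomorphisms surround a middle one, [g]. *)
have -> : ((2 ^ m.+1).-1 = (2 ^ m).-1 + (2 ^ m).-1.+1)%N.
  by rewrite prednK ?expn_gt0// expnS mul2n -addnn -!subn1 addnBAC ?expn_gt0.
move=> /(radp_split indX)[V [k [l' [indV /(IHm _ _ _ indX) hk [W [g [l [indW ng lp l'E]]]] fE]]]].
have {lp} hl := IHm _ _ _ indW lp.
have fkl : imsub f (full_submod X) `<=` imsub (l \o g) (imsub k (full_submod X)).
  by move=> _ [x _ <-]; exists (k x); [exists x | rewrite /= fE l'E].
have fl : imsub f (full_submod X) `<=` imsub l (full_submod W).
  by move=> _ [x _ <-]; exists (g (k x)); rewrite // fE l'E.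
rewrite subnS; case: (b - m)%N hk hl => [|r] hk hl; first exact: hle_sub fl hl.
have [[v [kv v0 lgv]]|K0] :=
    EM (exists v, [/\ imsub k (full_submod X) v, v <> 0 & l (g v) = 0]).
  by apply: hle_sub fkl _; apply: hle_im_ker hk; [exact: kv | exact: v0 | ].
have {}K0 v : imsub k (full_submod X) v -> l (g v) = 0 -> v = 0.
  by move=> kv lgv; apply: contrapT => v0; apply: K0; exists v.
have [e|ne] := EM (imsub f (full_submod X) = imsub l (full_submod W)); last first.
  exact/hl/submod_proper.
have fk w : exists x, l w = l (g (k x)).
  have : imsub f (full_submod X) (l w) by rewrite e; exists w.
  by move=> [x _ <-]; exists x; rewrite fE l'E.
have [_ [_ dV]] := indV; have [_ [_ dW]] := indW.
have [||I0|kerg] := dV (imsub k (full_submod X)) (ker (l \o g)).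
- move=> v; have [x lgx] := fk (g v); exists (k x), (v - k x).
  split; [by exists x | | by rewrite addrC subrK].
  by rewrite /= /preimage /= !linearB lgx subrr.
- apply/seteqP; split=> v; last by move=> ->; split; apply: submod0.
  by move=> [kv /(K0 v kv)].
- apply: hle_eq0 => _ [x _ <-]; rewrite fE l'E.
  have : imsub k (full_submod X) (k x) by exists x.
  by rewrite I0 => /= ->; rewrite !linear0.
have gi : injective g.
  apply: ker_inj => v gv; have : ker (l \o g) v by rewrite /= /preimage /= gv linear0.
  by rewrite kerg.
have [||I0|kerl] := dW (imsub (g \o k) (full_submod X)) (ker l).
- move=> w; have [x lw] := fk w; exists (g (k x)), (w - g (k x)).
  split; [by exists x | | by rewrite addrC subrK].
  by rewrite /= /preimage /= linearB lw subrr.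
- apply/seteqP; split=> w; last by move=> ->; split; apply: submod0.
  move=> [[x _ <-]]; rewrite /= /preimage /= => lgx; rewrite (K0 (k x)) ?linear0 //.
  by exists x.
- apply: hle_eq0 => _ [x _ <-]; rewrite fE l'E.
  have : imsub (g \o k) (full_submod X) (g (k x)) by exists x.
  by rewrite I0 => /= ->; rewrite !linear0.
have li : injective l.
  by apply: ker_inj => w lw; have : ker l w by []; rewrite kerl.
case: ng; split=> // w; have [x /li ->] := fk w.
by exists (k x).
Qed.

Lemma harada_sai X Y (f : {linear X -> Y}) : indec X -> radp (2 ^ b).-1 f ->
  forall x, f x = 0.
Proof.
move=> indX /(harada_sai_im indX); rewrite subnn => f0 x.
by apply: f0; exists x.
Qed.

End HaradaSai.

(** * Almost split sequences *)

Section Exactness.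
Variable A : pzRingType.
Implicit Types U V W X Y Z : lmodType A.

Definition split_mono V W (f : {linear V -> W}) := exists r : {linear W -> V}, cancel f r.

Definition short_exact U V W (i : {linear U -> V}) (q : {linear V -> W}) :=
  [/\ injective i, (forall w, exists v, q v = w) &
      forall v, q v = 0 <-> exists u, i u = v].

(** In particular, [lifts q idfun] says that [q] is a split epimorphism. *)
Definition lifts U V W (q : {linear V -> W}) (c : {linear U -> W}) :=
  exists s : {linear U -> V}, forall u, q (s u) = c u.

(** For a retraction [r] of [i], the map [1 - i r] vanishes on the kernel of [q], and its
    factorization through [q] is a section. *)
Lemma section_of_split U V W (i : {linear U -> V}) (q : {linear V -> W}) :
  short_exact i q -> split_mono i -> lifts q idfun.
Proof.
move=> [ii qs qi] [r ir].
have [|t tq] := lift_surj (g := (idfun \- (i \o r)) : {linear V -> V}) qs.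
  by move=> v /qi[u <-] /=; rewrite ir subrr.
exists t => w; have [v <-] := qs w; rewrite tq /= linearB.
by rewrite (iffRL (qi (i (r v)))) ?subr0 //; exists (r v).
Qed.

Lemma split_of_section U V W (i : {linear U -> V}) (q : {linear V -> W}) :
  short_exact i q -> lifts q idfun -> split_mono i.
Proof.
move=> [ii qs qi] [t qt].
have [|r ir] := lift_inj (g := (idfun \- (t \o q)) : {linear V -> V}) ii.
  by move=> v; apply/qi; rewrite linearB /= qt subrr.
exists r => u; apply: ii; rewrite ir /=.
rewrite (iffRL (qi (i u))); last by exists u.
by rewrite linear0 subr0.
Qed.

Lemma short_exact_coker U V (i : {linear U -> V}) : injective i ->
  short_exact i (quot_pi (imsub i (full_submod U))).
Proof.
move=> ii; split=> // [q|v]; first exact: quot_pi_surj.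
by split=> [/quot_pi_eq0[u _ <-]|[u <-]]; [exists u | apply/quot_pi_eq0; exists u].
Qed.

Lemma linear_pair_subproof U V W (f : {linear U -> V}) (g : {linear U -> W}) :
  linear (fun u => (f u, g u) : V * W).
Proof. by move=> a x y; congr pair; rewrite /= linearP. Qed.
Definition linear_pair U V W (f : {linear U -> V}) (g : {linear U -> W}) :
  {linear U -> (V * W)%type} := mk_linear (linear_pair_subproof f g).

(** Lifts of the inclusions of the indecomposable summands of [W] would add up to a section of
    [q]. *)
Lemma indec_nonlifting V W (q : {linear V -> W}) : finlen W -> ~ lifts q idfun ->
  exists Z (d : {linear Z -> W}), indec Z /\ ~ lifts q d.
Proof.
move=> /finlen_decomposable[l sumW] nq; apply: contrapT => nZ; apply: nq.
have lS (s : summand W) : lifts q (summand_incl s).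
  apply: contrapT => ns; apply: nZ; exists (summand_obj s), (summand_incl s).
  by split=> //; apply: summand_indec.
suff [s qs] : exists s : {linear W -> V},
    forall w, q (s w) = \sum_(s <- l) summand_incl s (summand_proj s w).
  by exists s => w; rewrite qs sumW.
elim: l {sumW} => [|s l [t qt]].
  by exists (\0 : {linear W -> V}) => w; rewrite big_nil linear0.
have [u qu] := lS s.
exists ((u \o summand_proj s) \+ t : {linear W -> V}) => w.
by rewrite big_cons linearD /= qu qt.
Qed.

End Exactness.

Section LeftAlmostSplit.
Variable A : pzRingType.
Implicit Types B D E V W X Y Z : lmodType A.
Variables (b : nat) (hleb : forall X, indec X -> hle b (full_submod X)).

(* Otherwise a non-lifting map could be precomposed with non-isomorphisms forever without
   becoming zero, against the Harada-Sai lemma. *)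
Lemma ex_almost_split_lifting V W (q : {linear V -> W}) : finlen W -> ~ lifts q idfun ->
  exists Z (c : {linear Z -> W}), [/\ indec Z, ~ lifts q c &
    forall D (d : {linear D -> Z}), indec D -> ~ is_iso d ->
      lifts q (c \o d : {linear D -> W})].
Proof.
move=> finW nq; apply: contrapT => nZ.
have [Z [c [indZ nc /(harada_sai hleb indZ) c0]]] :
    exists Z (c : {linear Z -> W}), [/\ indec Z, ~ lifts q c & radp (2 ^ b).-1 c].
  elim: (2 ^ b).-1 => [|n [Z [c [indZ nc radc]]]].
    by have [Z [d [indZ nd]]] := indec_nonlifting finW nq; exists Z, d.
  apply: contrapT => nD; apply: nZ; exists Z, c; split=> // D d indD nd.
  apply: contrapT => ncd; apply: nD; exists D, (c \o d : {linear D -> W}).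
  by split=> //; exists Z, d, c.
by apply: nc; exists (\0 : {linear Z -> V}) => u; rewrite linear0 c0.
Qed.

(** For [X] of finite length this is injectivity in the category of modules of finite length. *)
Definition relatively_injective X := forall B (i : {linear X -> B}),
  finlen B -> injective i -> split_mono i.

(** Only the lifting property on the right is built in; the extension property on the left is
    derived in [almost_split_seq_left]. *)
Definition almost_split_seq X E Z (e : {linear X -> E}) (q : {linear E -> Z}) :=
  [/\ short_exact e q, ~ split_mono e, indec Z &
    forall D (d : {linear D -> Z}), indec D -> ~ is_iso d -> lifts q d].

Lemma ex_almost_split_seq X : indec X -> ~ relatively_injective X ->
  exists E Z (e : {linear X -> E}) (q : {linear E -> Z}),
    finlen E /\ almost_split_seq e q.
Proof.
move=> indX /existsNP[B /existsNP[i /not_implyP[finB /not_implyP[ii ni]]]].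
have exi := short_exact_coker ii; move: exi; set p := quot_pi _ => exi.
have np : ~ lifts p idfun by move=> /(split_of_section exi).
have [Z [c [indZ nc maxc]]] := ex_almost_split_lifting (finlen_quot _ finB) np.
have [_ ps pi] := exi.
(* The pullback of [p] and [c], cut out of [B * Z]. *)
pose P := ker ((p \o fst_lin B Z) \- (c \o snd_lin B Z) : {linear _ -> _}).
have PE u : P u <-> p u.1 = c u.2.
  by rewrite /P /= /preimage /=; split=> [/subr0_eq|->]; rewrite ?subrr.
pose q := (snd_lin B Z \o submod_incl P) : {linear _ -> _}.
have [e eE] : exists e : {linear X -> submod_type P},
    forall x, submod_incl P (e x) = (inl_lin B Z \o i) x.
  apply: (lift_inj (@submod_incl_inj _ _ P)) => x; apply/submod_incl_im/PE => /=.
  by rewrite linear0; apply/pi; exists x.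
have exe : short_exact e q.
  split.
  - by move=> x y exy; apply: ii; have := eE x; rewrite exy eE => -[].
  - move=> z; have [v pv] := ps (c z).
    by have [u uE] := submod_incl_im (iffRL (PE (v, z)) pv); exists u; apply: (congr1 snd uE).
  - move=> u; split=> [qu|[x <-]]; last exact: (congr1 snd (eE x)).
    have /PE := submod_inclP u; rewrite -[(_ u).2]/(q u) qu linear0 => /pi[x ix].
    exists x; apply: submod_incl_inj; rewrite eE [RHS]surjective_pairing -ix.
    by congr pair; rewrite /= -qu.
exists (submod_type P), Z, e, q; split.
  by apply/finlen_submod/finlen_prod => //; case: indZ.
(* The universal property of the pullback turns the maximality of [c] among non-lifting maps into
   the almost split property of [q]. *)
have lq D (d : {linear D -> Z}) : lifts p (c \o d : {linear D -> _}) <-> lifts q d.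
  split=> [[s ps']|[s qs]].
    have [t tE] : exists t : {linear D -> submod_type P},
        forall x, submod_incl P (t x) = linear_pair s d x.
      apply: (lift_inj (@submod_incl_inj _ _ P)) => x.
      exact/submod_incl_im/PE/ps'.
    by exists t => x; apply: (congr1 snd (tE x)).
  exists (fst_lin B Z \o submod_incl P \o s : {linear _ -> _}) => x.
  have /PE sxP := submod_inclP (s x); apply: etrans sxP _.
  by apply: (congr1 c); apply: qs.
split=> //.
  move=> /(section_of_split exe) /lq [s cs]; apply: nc.
  by exists s.
by move=> D d indD nd; apply/lq/maxc.
Qed.

(* The quotient D0 = (E * Y) / X maps onto Z with kernel Y. An indecomposable D -> D0 that does
   not lift to E * Y cannot lift to E when composed with D0 -> Z, so D is isomorphic to Z and
   D0 -> Z splits; hence f extends to E. *)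
Lemma almost_split_seq_left X Y E Z (e : {linear X -> E}) (q : {linear E -> Z})
    (f : {linear X -> Y}) :
  indec X -> finlen Y -> finlen E -> almost_split_seq e q -> ~ split_mono f ->
  exists h : {linear E -> Y}, forall x, h (e x) = f x.
Proof.
move=> indX finY finE [[ei qs qe] ne indZ maxq] nf; apply: contrapT => next.
(* The sign makes the cokernel of [j] the pushout of [e] and [f]: it identifies [e x] with [f x]. *)
pose j := linear_pair e (\- f : {linear X -> Y}).
have ji : injective j by move=> x y [/ei].
have exj := short_exact_coker ji; move: exj; set p := quot_pi _ => exj.
have [_ ps pj] := exj.
(* A retraction of [j] writes the identity of [X] as a sum of an endomorphism through [e] and one
   through [f]. By locality one of them is injective, hence bijective, and [e] or [f] splits. *)
have nj : ~ split_mono j.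
  move=> [r rj].
  have [] := @indec_local _ X (r \o inl_lin E Y \o e) (r \o inr_lin E Y \o (\- f)) indX.
  - by move=> x; rewrite -[RHS]rj /= -linearD; congr (r (_, _)); rewrite ?addr0 ?add0r.
  - move=> re; apply: ne.
    have [|g [gK _]] := linear_inv re; first by apply: inj_endo_surj re; case: indX.
    by exists (g \o r \o inl_lin E Y : {linear _ -> _}).
  - move=> rf; apply: nf.
    have [|g [gK _]] := linear_inv rf; first by apply: inj_endo_surj rf; case: indX.
    exists (g \o r \o inr_lin E Y \o (\- idfun) : {linear _ -> _}) => x.
    exact: gK.
have [D [d [indD nd]]] :
    exists D (d : {linear D -> _}), indec D /\ ~ lifts p d.
  apply: indec_nonlifting; first exact/finlen_quot/finlen_prod.
  by move=> /(split_of_section exj).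
have [q' q'p] : exists q' : {linear _ -> Z}, forall v, q' (p v) = (q \o fst_lin E Y) v.
  by apply: lift_surj => // v /pj[x <-] /=; apply/qe; exists x.
have p0 y : p (0, y) = 0 -> y = 0.
  by move=> /pj[x [/= ex <-]]; rewrite (ei x 0) ?linear0 ?oppr0.
(* Over the point [q w] of [Z], a representative in [E * Y] can be chosen with first coordinate
   [w]. *)
have liftq v w : q' (p v) = q w -> exists y, p v = p (w, y).
  rewrite q'p /= => qvw; have [x ex] : exists x, e x = v.1 - w.
    by apply/qe; rewrite linearB qvw subrr.
  exists (v.2 + f x); apply/subr0_eq; rewrite -(linearB p); apply/pj; exists x.
  by case: v ex {qvw} => v1 v2 /= ex; congr pair => /=; rewrite ?ex // opprD addNKr.
have [[q'di q'ds]|nq'd] := EM (is_iso (q' \o d)).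
  have [t [_ tK]] := linear_inv (f := q' \o d : {linear _ -> _}) q'di q'ds.
  have exq' : short_exact (p \o inr_lin E Y : {linear _ -> _}) q'.
    split.
    - by apply: ker_inj => y; apply: p0.
    - by move=> z; exists (d (t z)); apply: tK.
    - move=> w; have [v <-] := ps w; split=> [q'v|[y <-]].
        by have [|y ->] := @liftq v 0; [rewrite q'v linear0 | exists y].
      by rewrite q'p /= linear0.
  have [|r rK] := split_of_section exq'; first by exists (d \o t : {linear _ -> _}) => z; apply: tK.
  apply: next; exists (r \o p \o inl_lin E Y : {linear _ -> _}) => x.
  rewrite -(rK (f x)) /=; congr (r _); apply/subr0_eq; rewrite -(linearB p).
  by apply/pj; exists x; congr pair; rewrite /= ?subr0 ?sub0r.
have [s qs'] := maxq _ (q' \o d : {linear _ -> _}) indD nq'd.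
apply: nd.
(* The lift of [d] takes its first coordinate from [s]; the second is then unique, because [Y]
   embeds in the quotient. *)
have [|||t tE] := @linear_of_rel _ D (E * Y)%type
  (fun u v => p v = d u /\ v.1 = s u).
- move=> u; have [v pv] := ps (d u).
  have [|y py] := @liftq v (s u); first by rewrite qs' pv.
  by exists (s u, y); rewrite -py.
- by move=> a x y x' y' [px sx] [py sy]; split; rewrite ?(linearP p) linearP ?px ?py //= sx sy.
- move=> x [y1 y2] [y1' y2'] [px sx] [py sy]; rewrite /= in sx sy.
  rewrite sx in px *; rewrite sy in py *; congr pair; apply/subr0_eq/p0.
  rewrite -(subrr (s x)) -[(_, _)]/((s x, y2) - (s x, y2')).
  by rewrite (linearB p) px py subrr.
- by exists t => u; case: (tE u).
Qed.

End LeftAlmostSplit.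

(** * Uniformity of relatively injective indecomposables *)

Section RelativelyInjective.
Variable A : pzRingType.
Implicit Types V W X Y Z : lmodType A.

Lemma ex_min_submod V n (P : submodule V -> Prop) (S : submodule V) :
  hle n S -> P S ->
  exists T, P T /\ forall U : submodule V, P U -> U `<=` T -> U = T.
Proof.
elim: n S => [|n IHn] S hS PS.
  exists S; split=> // U _ sUS; apply: submod_antisym => // x /hS ->.
  exact: submod0.
have [maxS|/existsNP[U /not_implyP[PU /not_implyP[sUS neU]]]] :=
    EM (forall U : submodule V, P U -> U `<=` S -> U = S); first by exists S.
exact: IHn (hS _ (submod_proper sUS neU)) PU.
Qed.

(* Extending (u + v |-> u) from U + V to an endomorphism contradicts locality of End X. *)
Lemma relatively_injective_uniform X (U V : submodule X) :
  indec X -> relatively_injective X -> U <> zero_submod X -> V <> zero_submod X ->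
  capsub U V <> zero_submod X.
Proof.
move=> indX injX U0 V0 UV0.
have nz (T : submodule X) : T <> zero_submod X -> exists2 x, T x & x <> 0.
  move=> T0; apply: contrapT => nx; apply: T0; apply: submod_antisym.
    by move=> x Tx; apply: contrapT => x0; apply: nx; exists x.
  exact: zero_submod_min.
(* Modulo [N] the two copies of each element of [U] agree and the second copy of [V] dies. As [U]
   and [V] meet in zero, the first copy of [X] still embeds, and a retraction onto it yields [e]. *)
pose N := sumsub (imsub (linear_pair idfun (\- idfun)) U) (imsub (inr_lin X X) V).
pose p := quot_pi N.
have finX : finlen X by case: indX.
have [||r rK] := injX _ (p \o inl_lin X X : {linear _ -> _}).
- exact/finlen_quot/finlen_prod.
- apply: ker_inj => x /quot_pi_eq0[_ [_ [[u Uu <-] [v Vv <-]]]].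
  move=> [-> uv]; rewrite addr0; have : capsub U V u; last by rewrite UV0.
  by split=> //; suff -> : u = v by []; apply/esym/subr0_eq; rewrite addrC -uv.
pose e := (r \o p \o inr_lin X X) : {linear X -> X}.
have eU u : U u -> e u = u.
  move=> Uu; rewrite -[RHS]rK; congr (r _); apply/esym/subr0_eq.
  rewrite -(linearB p); apply/quot_pi_eq0; exists (u, - u), 0.
  split; [by exists u | exact: submod0 | ].
  by congr pair; rewrite /= ?subr0 ?sub0r addr0.
have eV v : V v -> e v = 0.
  move=> Vv; rewrite -[RHS](linear0 r); congr (r _); apply/quot_pi_eq0.
  by apply: sumsubr; exists v.
have [v Vv v0] := nz V V0; have [u Uu u0] := nz U U0.
have [ei|e1] := indec_endo e indX; last exact/u0/e1/eU.
by apply: v0; apply: ei; rewrite eV // linear0.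
Qed.

End RelativelyInjective.

(** * The first Brauer-Thrall conjecture *)

Section BrauerThrall.
Variable A : pzRingType.
Implicit Types E M V W X Y Z : lmodType A.

Definition fin_class (P : lmodType A -> Prop) := exists l : seq (lmodType A),
  forall M, P M -> has (fun N => `[< isomorphic M N >]) l.

Lemma fin_class_has (T : Type) (Q : T -> lmodType A -> Prop) (l : seq T) :
  (forall t, fin_class (Q t)) -> fin_class (fun M => has (fun t => `[< Q t M >]) l).
Proof.
move=> finQ; elim: l => [|t l [l' fin']]; first by exists [::].
have [l0 fin0] := finQ t; exists (l0 ++ l') => M /= /orP[/asboolP/fin0|/fin'].
  by rewrite has_cat => ->.
by rewrite has_cat orbC => ->.
Qed.

Lemma has_sum_neq0 V Y (l : seq (summand V)) (h : {linear V -> Y}) (x : V) :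
  h (\sum_(s <- l) summand_incl s (summand_proj s x)) <> 0 ->
  has (fun s => `[< h (summand_incl s (summand_proj s x)) <> 0 >]) l.
Proof.
elim: l => [|s l IHl]; first by rewrite big_nil linear0.
rewrite big_cons linearD /=.
have [->|nz] := EM (h (summand_incl s (summand_proj s x)) = 0).
  by rewrite add0r => /IHl ->; rewrite orbT.
by move=> _; rewrite asboolT.
Qed.

Variables (b : nat) (hleb : forall X, indec X -> hle b (full_submod X)).

(** If [X] is relatively injective, uniformity gives a smallest nonzero submodule [S], and the
    projection modulo [S] serves: a map that is not a split monomorphism is not injective, so it
    kills [S]. Otherwise an almost split sequence provides [e]. *)
Lemma ex_left_almost_split X : indec X ->
  exists E (e : {linear X -> E}), [/\ finlen E, ~ split_mono e &
    forall Y (f : {linear X -> Y}), finlen Y -> ~ split_mono f ->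
      exists h : {linear E -> Y}, forall x, h (e x) = f x].
Proof.
move=> indX; have [injX|ninjX] := EM (relatively_injective X); last first.
  have [E [Z [e [q [finE ase]]]]] := ex_almost_split_seq hleb indX ninjX.
  exists E, e; split=> //; first by case: ase.
  by move=> Y f finY; apply: (almost_split_seq_left indX finY finE ase).
have [finX _] := indX; have [n hX] := finX.
have [|S [S0 minS]] := @ex_min_submod _ X n (fun S => S <> zero_submod X) _ hX.
  by have [x x0] := indec_nz indX; move=> e; have : full_submod X x by []; rewrite e.
have sS T : T <> zero_submod X -> S `<=` T.
  move=> T0; suff <- : capsub T S = S by move=> x [].
  apply: minS; last by move=> x [].
  exact: relatively_injective_uniform T0 S0.
exists (quot_module S), (quot_pi S); split; first exact: finlen_quot.
  move=> [r rK]; apply: S0; apply: submod_antisym; last exact: zero_submod_min.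
  by move=> x /quot_pi_eq0 Sx; rewrite /= -[x]rK Sx linear0.
move=> Y f finY nf; apply: lift_surj; first exact: quot_pi_surj.
have /sS sSK : ker f <> zero_submod X.
  move=> K0; apply: nf; apply: injX => //.
  by apply: ker_inj => y fy; have : ker f y by []; rewrite K0.
by move=> x /quot_pi_eq0 /sSK.
Qed.

(** Induction on [n] follows the element [x]. A non-isomorphism [h] to an indecomposable factors
    through [e], so it is nonzero on the component of [e x] in some summand of [E]. The components
    of [e] are non-isomorphisms, as [e] does not split, so each uses up one unit of [n]. *)
Lemma fin_class_nonzero_at n X (x : X) : indec X ->
  (forall Y (h : {linear X -> Y}), radp n h -> h x = 0) ->
  fin_class (fun Y => indec Y /\ exists h : {linear X -> Y}, h x <> 0).
Proof.
elim: n X x => [|n IHn] X x indX radx.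
  (* For [n = 0] the identity is an admissible [h], so [x] is zero and the class is empty. *)
  exists [::] => Y [_ [h]]; have /= -> := radx X idfun I.
  by rewrite linear0.
have [E [e [finE ne ase]]] := ex_left_almost_split indX.
have [l sumE] := finlen_decomposable finE.
have [|l' fin'] := @fin_class_has _ (fun s Y => indec Y /\
    exists h : {linear summand_obj s -> Y}, h (summand_proj s (e x)) <> 0) l.
  move=> s; apply: IHn => [|Y h radh]; first exact: summand_indec.
  apply: (radx _ (h \o summand_proj s \o e : {linear _ -> _})).
  exists (summand_obj s), (summand_proj s \o e : {linear _ -> _}), h.
  split=> //; first exact: summand_indec.
  move=> [pi ps]; have [g [gK _]] := linear_inv pi ps; apply: ne.
  by exists (g \o summand_proj s : {linear _ -> _}).
exists (X :: l') => Y [indY [h hx]] /=; apply/orP.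
have [isoh|nh] := EM (is_iso h).
  by left; apply/asboolP/isomorphic_sym/(is_iso_isomorphic isoh).
have [||h' h'E] := ase Y h; first by case: indY.
  by move=> [r hK]; apply: nh; case: (retract_iso indX indY hK).
right; apply: fin'; rewrite -h'E -(sumE (e x)) in hx.
apply: sub_has (has_sum_neq0 hx) => s /asboolP hs; apply/asboolP; split=> //.
by exists (h' \o summand_incl s : {linear _ -> _}).
Qed.

(** A nonzero [y] in [Y] gives a map from the regular module that is nonzero at [1], hence at the
    component of [1] in some indecomposable summand. The Harada-Sai lemma makes
    [fin_class_nonzero_at] applicable to each summand. *)
Theorem brauer_thrall : finlen A^o -> fin_class (@indec A).
Proof.
move=> /finlen_decomposable[l sumA].
have [|l' fin'] := @fin_class_has _ (fun s Y => indec Y /\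
    exists h : {linear summand_obj s -> Y}, h (summand_proj s (1 : A^o)) <> 0) l.
  move=> s; have inds := summand_indec s.
  apply: (fin_class_nonzero_at (n := (2 ^ b).-1) inds) => Y h radh.
  exact: (harada_sai hleb inds radh).
exists l' => Y indY; apply: fin'; have [y y0] := indec_nz indY.
have hL : linear (fun a : A^o => (a : A) *: y : Y) by move=> a u v; rewrite scalerDl scalerA.
pose h := mk_linear hL; have hx : h 1 <> 0 by rewrite /h /= scale1r.
rewrite -(sumA 1) in hx.
apply: sub_has (has_sum_neq0 hx) => s /asboolP hs; apply/asboolP; split=> //.
by exists (h \o summand_incl s : {linear _ -> _}).
Qed.

End BrauerThrall.

(** * Finite length over artin algebras *)

Section FinitelyGenerated.
Variable A : pzRingType.
Implicit Types V W : lmodType A.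

Definition span V (l : seq V) : submodule V :=
  foldr (fun x S => sumsub (cycsub x) S) (zero_submod V) l.

Lemma spanP V (l : seq V) x : span l x ->
  exists c : nat -> A, x = \sum_(i < size l) c i *: l`_i.
Proof.
elim: l x => [|y l IHl] x /=; first by move=> ->; exists (fun=> 0); rewrite big_ord0.
move=> [u [z [uy lz ->]]]; have [a ->] : cycsub y u by [].
have [c ->] := IHl z lz.
by exists (fun i => if i is j.+1 then c j else a); rewrite big_ord_recl.
Qed.

Lemma hle_cycsub V n (x : V) : hle n (full_submod A^o) -> hle n (cycsub x).
Proof.
have fL : linear (fun a : A^o => (a : A) *: x : V).
  by move=> a u v; rewrite scalerDl scalerA.
move=> /(hle_im (mk_linear fL)); apply: hle_sub => _ [a ->].
by exists a.
Qed.

Lemma fin_gen_finlen V : finlen A^o -> fin_gen V -> finlen V.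
Proof.
move=> [n hA] [k [g gV]].
have [m hm] : exists m, hle m (span (codom g)).
  elim: (codom g) => [|x l [m hm]]; first by exists 0%N.
  by exists (n + m)%N; apply: hle_sum => //; apply: hle_cycsub.
exists m; apply: hle_sub hm => x _; have [c ->] := gV x.
apply: submod_sum => i; apply: submodZ.
have : g i \in codom g by apply: codom_f.
elim: (codom g) => // y l IHl; rewrite inE => /orP[/eqP->|/IHl].
  exact/sumsubl/cycsub_id.
exact: sumsubr.
Qed.

Lemma finlen_fin_gen V : finlen V -> fin_gen V.
Proof.
move=> [n hV]; have [l lV] : exists l, full_submod V `<=` span l.
  elim: n (full_submod V) hV => [|n IHn] S hS; first by exists [::].
  have [->|S0] := EM (S = zero_submod V); first by exists [::].
  (* A maximal submodule [M] and any one element outside it generate [S]. *)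
  have [|M [MS maxM] _] := @ex_maximal_submod _ _ _ (zero_submod V) S _ hS.
    by apply: submod_proper; [apply: zero_submod_min | move=> /esym].
  have [l lM] := IHn M (hS M MS); have [sMS [x Sx nMx]] := submod_properE MS.
  exists (x :: l) => y Sy /=; have sMN : M `<=` sumsub (cycsub x) M by apply: sumsubr.
  have [|e|e] := maxM (sumsub (cycsub x) M) sMN.
  - by apply: sumsub_min => //; apply: cycsub_min.
  - by case: nMx; rewrite -e; apply/sumsubl/cycsub_id.
  - rewrite -e in Sy; have [u [v [xu Mv ->]]] := Sy.
    by exists u, v; split=> //; apply: lM.
exists (size l), (fun i => l`_i) => x; have [c ->] := spanP (lV x I).
by exists (fun i => c i).
Qed.

End FinitelyGenerated.

(** * Finite length of commutative artinian rings *)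

Section Artinian.
Variable R : comPzRingType.
Implicit Types S T J : submodule R^o.
Hypothesis artR : artinian R.

Lemma artinian_min (P : submodule R^o -> Prop) S : P S ->
  exists T, P T /\ forall U, P U -> U `<=` T -> U = T.
Proof.
move=> PS; apply: contrapT => nT.
have next (T : {T | P T}) : exists U : {T | P T}, sval U `<` sval T.
  apply: contrapT => nU; apply: nT; exists (sval T); split; first exact: svalP.
  move=> U PU sUT; apply: contrapT => neU; apply: nU; exists (exist _ U PU).
  exact: submod_proper.
have [g gP] := choice next.
have [//|k kP] := artR (I := fun i => sval (iter i g (exist _ S PS))).
  by move=> i; case: (gP (iter i g (exist _ S PS))).
have [_ []] := gP (iter k g (exist _ S PS)).
by rewrite -iterS kP.
Qed.

Lemma mulr_linear (a : R) : linear ( *%R a : R^o -> R^o).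
Proof. by move=> b x y; rewrite mulrDr /GRing.scale /= mulrCA. Qed.

(** The powers of [c] generate a descending chain of ideals; where it becomes stable, [c ^ n] is a
    multiple of [c ^ n.+1]. *)
Lemma artinian_power_unit (c : R) : exists n d, c ^+ n * (1 - c * d) = 0.
Proof.
have [i|k kP] := artR (I := fun i => cycsub (c ^+ i : R^o)).
  by apply: cycsub_min; exists c; rewrite exprS.
have [d dP] : cycsub (c ^+ k.+1 : R^o) (c ^+ k) by rewrite kP //; apply: cycsub_id.
exists k, d; rewrite mulrBr mulr1 {1}dP exprS /GRing.scale /=.
by rewrite -[d * _]mulrC -mulrA -mulrCA mulrA subrr.
Qed.

(* An ideal J minimal among those of infinite length is a vector space over the field R / Ann J.
   A subspace of J maximal among those avoiding some x <> 0 is a hyperplane, of finite length by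
   minimality of J, so J has finite length after all. *)
Lemma artinian_finlen : finlen R^o.
Proof.
apply: contrapT => ninf.
have [J [nJ minJ]] := @artinian_min (fun S => ~ exists n, hle n S) (full_submod R^o) ninf.
have finJ T : T `<` J -> exists n, hle n T.
  by move=> [sTJ nTJ]; apply: contrapT => /minJ /(_ sTJ) e; apply: nTJ; rewrite e.
(* If [a J] is proper in [J], it has finite length; were the kernel of [a] on [J] proper too, [J]
   would have finite length. *)
have aJ (a : R) : (forall x, J x -> exists2 y, J y & x = a * y) \/ (forall x, J x -> a * x = 0).
  pose f := mk_linear (mulr_linear a).
  have fJ : imsub f J `<=` J by move=> _ [x Jx <-]; apply: submodZ.
  have [e|ne] := EM (imsub f J = J).
    by left=> x; rewrite -{1}e => -[y Jy <-]; exists y.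
  right; have [n hn] := finJ _ (submod_proper fJ ne).
  have [e|nK] := EM (capsub J (ker f) = J).
    by move=> x; rewrite -e => -[].
  have sKJ : capsub J (ker f) `<=` J by move=> x [].
  have [m hm] := finJ _ (submod_proper sKJ nK).
  by case: nJ; exists (m + n)%N; apply: hle_ext hm hn.
(* Here [c] is surjective on [J]. If [1 - c d] were too, so would be [c ^ n (1 - c d) = 0], against
   [c x <> 0]. Hence [1 - c d] kills [J], and [d] inverts [c] there. *)
have invJ (c x y : R) : J x -> c * x <> 0 -> J y -> exists d, d * (c * y) = y.
  move=> Jx cx Jy; have [n [d cnd]] := artinian_power_unit c.
  exists d; have [cJ|/(_ x Jx)//] := aJ c.
  have [uJ|/(_ y Jy)/eqP] := aJ (1 - c * d); last first.
    by rewrite mulrBl mul1r subr_eq0 => /eqP {2}->; rewrite mulrA [d * c]mulrC.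
  case: cx; have [z Jz ->] : exists2 z, J z & x = c ^+ n * z.
    elim: (n) x Jx => [|m IHm] x Jx; first by exists x; rewrite ?expr0 ?mul1r.
    have [z Jz ->] := cJ x Jx; have [w Jw ->] := IHm z Jz.
    by exists w => //; rewrite exprS mulrA.
  by have [w _ ->] := uJ z Jz; rewrite [_ ^+ _ * _]mulrA cnd mul0r mulr0.
have [x Jx x0] : exists2 x, J x & x <> 0.
  apply: contrapT => nx; apply: nJ; exists 0%N => x Jx; apply: contrapT => x0.
  by apply: nx; exists x.
have simplex : hle 1 (cycsub (x : R^o)).
  move=> T /submod_properE[sTx [_ [a ->] nTax]] y Ty; apply: contrapT => y0.
  have [c yE] := sTx y Ty; rewrite yE in y0.
  have [d dE] := invJ c x x Jx y0 Jx.
  apply: nTax; apply: submodZ; rewrite -dE -[c * x]/(c *: (x : R^o)) -yE.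
  exact: submodZ Ty.
pose P (B : set R^o) := [/\ forall a u v, B u -> B v -> B (a *: u + v), B `<=` J & ~ B x].
have [F FP totF|B [[BDZ BJ Bx] maxB]] := @Zorn_bigcup R^o P.
  split=> [a u v [C FC Cu] [D FD Dv]|u [C FC]|[C FC Cx]].
  - have [CD|DC] := totF C D FC FD.
      by exists D => //; case: (FP D FD) => DDZ _ _; apply: DDZ => //; apply: CD.
    by exists C => //; case: (FP C FC) => CDZ _ _; apply: CDZ => //; apply: DC.
  - by case: (FP C FC) => _ + _; apply.
  - by case: (FP C FC).
have maxB' (C : submodule R^o) : B `<` C -> C `<=` J -> C x.
  move=> BC CJ; apply: contrapT => nCx; apply: (maxB C BC); split=> //.
  by move=> a u v; apply: submodDZ.
(* The union of the empty chain requires [P] to admit the empty set, so [B 0] must come from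
   maximality: an empty [B] could be enlarged to the zero submodule, which avoids [x]. *)
have B0 : B 0.
  apply: contrapT => nB0; apply: x0; apply: (maxB' (zero_submod R^o)).
    have Be u : ~ B u by move=> Bu; apply: nB0; rewrite -(addNr u) -scaleN1r; apply: BDZ.
    by split=> [u /Be//|/(_ 0 erefl)].
  by move=> _ ->; apply: submod0.
pose T := mk_submodule B0 BDZ.
have [m hT] : exists m, hle m T by apply: finJ; split=> // /(_ x Jx).
apply: nJ; exists (m + 1)%N; apply: hle_sub (hle_sum hT simplex) => y Jy.
have [Ty|nTy] := EM (T y); first exact: sumsubl.
(* By maximality [x = t + c y]; since [c] acts invertibly on [J], this can be solved for [y]. *)
have [||t [_ [Tt [c ->] xE]]] := maxB' (sumsub T (cycsub (y : R^o))).
- split=> [|sTB]; first exact: (@sumsubl _ _ T).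
  by apply: nTy; apply: sTB; apply/sumsubr/cycsub_id.
- by apply: sumsub_min => //; apply: cycsub_min.
have cy : c * y <> 0.
  move=> cy; apply: Bx; rewrite xE -[c *: _]/(c * y) cy addr0; exact: Tt.
have [d <-] := invJ c y y Jy cy Jy.
have -> : c * y = x - t by rewrite xE addrC addKr.
exists (- (d *: t)), (d *: (x : R^o)); split; [ | by exists d | ].
  by apply: submodN; apply: submodZ.
by rewrite mulrBr addrC.
Qed.

End Artinian.

(** * Uniserial and factor serial modules *)

Section CompositionSeries.
Variables (A : pzRingType) (V : lmodType A).
Implicit Types (S T U M N : submodule V) (s t : seq (submodule V)).

(** Composition series with an arbitrary starting term, which can be cut and concatenated. *)
Fixpoint steps S s : Prop :=
  if s is T :: s' then maximal_submod_of T S /\ steps T s' else True.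

Lemma stepsP S s : steps S s <-> forall i, (i < size s)%N ->
  maximal_submod_of (nth (zero_submod V) s i) (nth (zero_submod V) (S :: s) i).
Proof.
elim: s S => [//|T s IHs] S /=; split=> [[TS /IHs Ts] [|i]|H]; [by []|exact: Ts|].
by split; [exact: (H 0%N) | apply/IHs => i; exact: (H i.+1)].
Qed.

Lemma composition_seriesE s :
  composition_series s <-> last (zero_submod V) s = full_submod V /\ steps (zero_submod V) s.
Proof. by split=> -[s1 s2]; split=> //; apply/stepsP. Qed.

Lemma steps_cat S s t : steps S (s ++ t) <-> steps S s /\ steps (last S s) t.
Proof.
elim: s S => [|T s IHs] S /=; first by split=> [|[]].
by split=> [[TS /IHs[? ?]]|[[? ?] ?]]; split=> //; apply/IHs.
Qed.

Lemma steps_rcons S s T : steps S (rcons s T) <-> steps S s /\ maximal_submod_of T (last S s).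
Proof. by rewrite -cats1; split=> [/steps_cat[? []]|[? ?]] //; apply/steps_cat. Qed.

Lemma steps_sub S s : steps S s -> S `<=` last S s.
Proof.
elim: s S => [|T s IHs] S /=; first by move=> _ x.
by move=> [[[sST _] _] /IHs]; apply: subset_trans.
Qed.

Lemma ex_steps n S T : S `<=` T -> hle n T -> exists2 s, steps S s & last S s = T.
Proof.
elim: n T => [|n IHn] T sST hT.
  by exists [::] => //=; apply: submod_antisym => // x /hT ->; apply: submod0.
have [->|neST] := EM (S = T); first by exists [::].
have [M TM sSM] := ex_maximal_submod (submod_proper sST neST) hT.
have [|s Ss sM] := IHn M sSM; first by apply: hT; case: TM.
by exists (rcons s T); [apply/steps_rcons; rewrite sM | rewrite last_rcons].
Qed.

(** The image of [T] modulo [S] is simple, so it contributes one unit in [hle_ext]. *)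
Lemma hle_maximal m S T : maximal_submod_of T S -> hle m S -> hle m.+1 T.
Proof.
move=> [[sST nTS] maxS] hS; rewrite -addn1; apply: (hle_ext (f := quot_pi S)).
  by apply: hle_sub hS => x [_ /quot_pi_eq0].
move=> W /submod_properE[sW [_ [x Tx <-] nWx]] w Ww.
have sSU : S `<=` capsub T (presub (quot_pi S) W).
  move=> y Sy; split; [exact: sST | rewrite -[_ y]/(W (quot_pi S y))].
  by rewrite (iffRL (quot_pi_eq0 S y) Sy); apply: submod0.
have [|e|e] := maxS _ sSU; first by move=> y [].
  have [y Ty yw] := sW w Ww; rewrite -yw; apply/quot_pi_eq0; rewrite -e.
  by split=> //; rewrite -[_ y]/(W (quot_pi S y)) yw.
by have [_] : capsub T (presub (quot_pi S) W) x by rewrite e.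
Qed.

Lemma hle_steps m S s : steps S s -> hle m S -> hle (m + size s) (last S s).
Proof.
elim: s m S => [|T s IHs] m S /=; first by rewrite addn0.
by move=> [TS Ts] hS; rewrite addnS -addSn; apply: IHs => //; apply: hle_maximal TS hS.
Qed.

Lemma has_length_hle l : has_length V l -> hle l (full_submod V).
Proof.
move=> [s /composition_seriesE[<- /hle_steps h] <-]; rewrite -[size s]add0n.
exact: h.
Qed.

Lemma steps_size S s n : steps S s -> hle n (last S s) -> (size s <= n)%N.
Proof.
elim/last_ind: s n => [//|s T IHs] n /steps_rcons[Ss [ST _]]; rewrite last_rcons => hT.
by have [m -> hm] := hle_proper ST hT; rewrite size_rcons; apply: IHs.
Qed.

Lemma has_length_le l n : has_length V l -> hle n (full_submod V) -> (l <= n)%N.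
Proof.
move=> [s /composition_seriesE[sV st] <-]; rewrite -sV; exact: steps_size.
Qed.

Lemma ex_has_length : finlen V -> exists l, has_length V l.
Proof.
move=> [n hV]; have [|s st sV] := @ex_steps n (zero_submod V) (full_submod V) _ hV.
  exact: zero_submod_min.
by exists (size s), s => //; apply/composition_seriesE.
Qed.

Definition total_submod := forall S T, S `<=` T \/ T `<=` S.

(** Every submodule is a term of some composition series, hence of the only one, [c]. *)
Lemma uniserial_total : finlen V -> uniserial V -> total_submod.
Proof.
move=> [n hV] [c [/composition_seriesE[_ cV] uniq_c]].
have through S : exists s t, c = s ++ t /\ last (zero_submod V) s = S.
  have [||s ss sS] := @ex_steps n (zero_submod V) S.
  - exact: zero_submod_min.
  - exact: hle_sub hV.
  have [|t tt tV] := @ex_steps n S (full_submod V) _ hV; first by move=> x.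
  exists s, t; split=> //; apply: uniq_c; apply/composition_seriesE.
  by rewrite last_cat sS; split=> //; apply/steps_cat; rewrite sS.
have cmp s t s' t' : c = s ++ t -> c = s' ++ t' -> (size s <= size s')%N ->
    last (zero_submod V) s `<=` last (zero_submod V) s'.
  move=> es es' les.
  have [d e] : exists d, s' = s ++ d.
    exists (drop (size s) s'); rewrite -{1}(cat_take_drop (size s) s'); congr (_ ++ _).
    by rewrite -(takel_cat t' les) -es' es take_size_cat.
  rewrite e last_cat; apply: steps_sub.
  by move: cV; rewrite es' e -catA => /steps_cat[_ /steps_cat[]].
move=> S T; have [s [s' [es <-]]] := through S; have [t [t' [et <-]]] := through T.
by case/orP: (leq_total (size s) (size t)) => le_st; [left|right]; apply: cmp le_st; eauto.
Qed.

(** Two composition series are compared from the top down, and [C] passes to each term met on the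
    way. It is applied to all submodules and to the iterated radicals. *)
Lemma uniserial_of_unique_maximal (C : submodule V -> Prop) :
  finlen V -> C (full_submod V) ->
  (forall T M, C T -> maximal_submod_of T M -> C M) ->
  (forall T M M', C T -> maximal_submod_of T M -> maximal_submod_of T M' -> M = M') ->
  uniserial V.
Proof.
move=> [n hV] CV Cmax uniqC.
have uniq_s s s' : C (last (zero_submod V) s) ->
    last (zero_submod V) s = last (zero_submod V) s' ->
    steps (zero_submod V) s -> steps (zero_submod V) s' -> s = s'.
  have nmax0 t S : ~ maximal_submod_of (zero_submod V) (last S t).
    by move=> [[_]] + _; apply; apply: zero_submod_min.
  elim/last_ind: s s' => [|s T IHs] s'; case/lastP: s' => [//|s' T'] /=;
    rewrite ?last_rcons => CT.
  - by move=> <- _ /steps_rcons[_ /nmax0].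
  - by move=> -> /steps_rcons[_ /nmax0].
  - move=> <- /steps_rcons[ss sT] /steps_rcons[ss' sT'].
    rewrite (IHs s') //; first exact: Cmax sT.
    exact: uniqC sT sT'.
have [|s ss sV] := @ex_steps n (zero_submod V) (full_submod V) _ hV.
  exact: zero_submod_min.
exists s; split; first exact/composition_seriesE.
move=> s' /composition_seriesE[s'V ss'].
by apply: uniq_s => //; rewrite ?sV ?s'V.
Qed.

Lemma maximal_total T M M' : (M `<=` M' \/ M' `<=` M) ->
  maximal_submod_of T M -> maximal_submod_of T M' -> M = M'.
Proof.
move=> + [[sMT nTM] maxM] [[sM'T nTM'] maxM'].
move=> [sMM'|sM'M]; last by have [//|e] := maxM' M sM'M sMT; case: nTM; rewrite e.
by have [//|e] := maxM M' sMM' sM'T; case: nTM'; rewrite e.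
Qed.

Lemma total_uniserial : finlen V -> total_submod -> uniserial V.
Proof.
move=> finV tot; apply: (@uniserial_of_unique_maximal (fun=> True)) => // T M M' _.
exact: maximal_total.
Qed.

Lemma rad_sub N : Defs.rad N `<=` N. Proof. by move=> x []. Qed.

Lemma rad_sub_maximal N M : maximal_submod_of N M -> Defs.rad N `<=` M.
Proof. by move=> maxM x [_]; apply. Qed.

Lemma rad_iter_sub i j : (i <= j)%N -> rad_iter V j `<=` rad_iter V i.
Proof.
move=> /subnK <-; elim: (j - i)%N => // k IHk; rewrite addSn.
exact: subset_trans (@rad_sub _) IHk.
Qed.

Lemma hle_rad n N : hle n N -> hle n.-1 (Defs.rad N).
Proof.
have [->|N0] := EM (N = zero_submod V).
  by move=> _; apply: hle_eq0; apply: rad_sub.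
move=> hN; have [|M maxM _] := @ex_maximal_submod _ _ n (zero_submod V) N _ hN.
  by apply: submod_proper; [apply: zero_submod_min | move=> /esym].
have [m -> hM] := hle_proper (proj1 maxM) hN.
exact: hle_sub (rad_sub_maximal maxM) hM.
Qed.

Lemma hle_rad_iter n i k : hle n (rad_iter V i) -> hle (n - k) (rad_iter V (k + i)).
Proof.
move=> hi; elim: k => [|k IHk]; first by rewrite subn0.
by rewrite subnS; apply: hle_rad.
Qed.

(** Each radical step lowers the length bound by at least one. A maximal submodule different from
    the radical would make some step lower it by two, and [rad_iter V l.-1] would vanish. *)
Lemma uniserial_of_rad l : hle l (full_submod V) ->
  rad_iter V l.-1 <> zero_submod V -> uniserial V.
Proof.
move=> hl radl.
have uniq_rad j M : maximal_submod_of (rad_iter V j) M -> M = rad_iter V j.+1.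
  move=> maxM; apply: contrapT => neM; apply: radl.
  have [sMj _] := maxM; have sradM : rad_iter V j.+1 `<` M.
    by apply: submod_proper; [apply: rad_sub_maximal | move=> /esym].
  have hj := hle_rad_iter j (hl : hle l (rad_iter V 0)); rewrite addn0 in hj.
  have [m em hM] := hle_proper sMj hj; have [p ep hp] := hle_proper sradM hM.
  have lj : l = (p + j.+2)%N.
    have jl : (j <= l)%N by rewrite ltnW // -subn_gt0 em.
    by rewrite -(subnK jl) em ep !addnS !addSn.
  have := hle_rad_iter p hp; rewrite subnn lj => h.
  apply: submod_antisym; last exact: zero_submod_min.
  by move=> x; rewrite addnS /=; apply: h.
apply: (@uniserial_of_unique_maximal (fun T => exists j, T = rad_iter V j)).
- by exists l.
- by exists 0%N.
- by move=> _ M [j ->] /uniq_rad ->; exists j.+1.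
- by move=> _ M M' [j ->] /uniq_rad -> /uniq_rad ->.
Qed.

End CompositionSeries.

(** * Factor serial modules and their length *)

Section FactorSerial.
Variables (A : pzRingType) (V : lmodType A).
Implicit Types (S T M N : submodule V).

Lemma uniserial_quot_total N S T : finlen V -> uniserial (quot_module N) ->
  N `<=` S -> N `<=` T -> S `<=` T \/ T `<=` S.
Proof.
move=> finV uniN.
have im_sub (U U' : submodule V) : N `<=` U' ->
    imsub (quot_pi N) U `<=` imsub (quot_pi N) U' -> U `<=` U'.
  move=> sNU' sU x Ux; have [|y U'y yx] := sU (quot_pi N x); first by exists x.
  rewrite -(subrK y x); apply: submodD => //; apply/sNU'/quot_pi_eq0.
  by rewrite linearB yx subrr.
move=> sNS sNT; have [] := uniserial_total (finlen_quot N finV) uniN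
  (imsub (quot_pi N) S) (imsub (quot_pi N) T).
  by move=> /(im_sub _ _ sNT); left.
by move=> /(im_sub _ _ sNS); right.
Qed.

Lemma uniserial_quot0 N : finlen V -> N = zero_submod V ->
  uniserial (quot_module N) -> uniserial V.
Proof.
move=> finV -> uni0; apply: total_uniserial => // S T.
by apply: (uniserial_quot_total finV uni0); apply: zero_submod_min.
Qed.

Lemma uniserial_quot_full N : N = full_submod V -> uniserial (quot_module N).
Proof.
move=> eN; have q0 (q q' : quot_module N) : q = q'.
  have [x <-] := quot_pi_surj q; have [y <-] := quot_pi_surj q'.
  by apply/subr0_eq; rewrite -linearB; apply/quot_pi_eq0; rewrite eN.
apply: total_uniserial => [|S T].
  by exists 0%N => q _; apply: q0.
by left=> q _; rewrite (q0 q 0); apply: submod0.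
Qed.

Lemma ex_factor_serial l : nonzero_module V -> has_length V l ->
  exists2 i, (1 <= i <= l)%N & factor_serial i V.
Proof.
move=> nzV lenV; have hV := has_length_hle lenV; have finV : finlen V by exists l.
have l0 : (0 < l)%N.
  by case: l hV {lenV} => // hV; have [x /eqP []] := nzV; apply: hV.
have [uniV|nuniV] := EM (uniserial V).
  by exists 1%N; rewrite ?l0 //; split=> //; exists l => //; left.
pose Q k := uniserial (quot_module (rad_iter V k)).
have nQ k : rad_iter V k = zero_submod V -> ~ Q k.
  by move=> rad0 /(uniserial_quot0 finV rad0).
have radl : rad_iter V l = zero_submod V.
  have := @hle_rad_iter _ V l 0 l hV; rewrite subnn addn0 => rad0.
  by apply: submod_antisym => //; apply: zero_submod_min.
(* The quotient by [rad_iter V 0] is zero, hence uniserial, while the quotient by [rad_iter V l] is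
   [V] up to isomorphism, which is not; so [Q] fails for the first time after some [k]. *)
have [k lt_kl [Qk nQk]] : exists2 k, (k < l)%N & Q k /\ ~ Q k.+1.
  apply: contrapT => nk; suff Qi i : (i <= l)%N -> Q i by apply: nQ radl _; apply: Qi.
  elim: i => [_|i IHi lt_il]; first exact: uniserial_quot_full.
  by apply: contrapT => nQi; apply: nk; exists i => //; split=> //; apply/IHi/ltnW.
(* The value [k = l - 1] is impossible: if [rad_iter V k] is zero, [Q k] makes [V] uniserial, and if
   it is nonzero, [uniserial_of_rad] does. *)
have lt1 : (1 < l - k)%N.
  rewrite ltn_subRL addn1 ltn_neqAle lt_kl andbT; apply/eqP => ekl.
  have [rad0|nrad0] := EM (rad_iter V k = zero_submod V); first exact: nQ rad0 Qk.
  by apply: nuniV; apply: (uniserial_of_rad hV); rewrite -ekl.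
exists (l - k)%N; first by rewrite leq_subr ltnW.
split=> //; exists l => //; right.
by rewrite leq_subr subKn ?addn1 //; apply: ltnW.
Qed.

(** Comparable maximal submodules coincide, so there is only one. It contains every proper
    submodule, and any element outside it generates [V]. *)
Lemma cyclic_of_total_maximal : finlen V -> nonzero_module V ->
  (forall M M', maximal_submod_of (full_submod V) M ->
    maximal_submod_of (full_submod V) M' -> M `<=` M' \/ M' `<=` M) ->
  exists x, full_submod V `<=` cycsub x.
Proof.
move=> [n hV] [x0 /eqP nx0] tot.
have prop S : S <> full_submod V -> exists2 M, maximal_submod_of (full_submod V) M & S `<=` M.
  by move=> neS; apply: ex_maximal_submod hV; apply: submod_proper.
have [|M maxM _] := prop (zero_submod V).
  by move=> e; have : full_submod V x0 by []; rewrite -e.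
have [_ [x _ nMx]] := submod_properE (proj1 maxM).
exists x; apply: contrapT => nx; have [|M' maxM' xM'] := prop (cycsub x).
  by move=> e; apply: nx; rewrite e.
apply: nMx; rewrite (maximal_total (tot M M' maxM maxM') maxM maxM').
exact/xM'/cycsub_id.
Qed.

(** Unless [V] is uniserial or [l <= i], every maximal submodule contains [rad_iter V (l - i)], and
    the uniserial quotient makes them comparable. So [V] is cyclic and [c] bounds its length; the
    uniserial case is similar. *)
Lemma factor_serial_hle i c : hle c (full_submod A^o) -> factor_serial i V ->
  hle (maxn i c) (full_submod V).
Proof.
move=> hA [nzV [l lenV fsV]]; have hV := has_length_hle lenV.
have finV : finlen V by exists l.
have cyc_hle : (exists x, full_submod V `<=` cycsub x) -> hle (maxn i c) (full_submod V).
  move=> [x sVx]; apply: hle_sub sVx _; apply: hleW (leq_maxr _ _) _.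
  exact: hle_cycsub.
case: fsV => [[_ uniV]|[_ le_il uniQ _]].
  apply/cyc_hle/cyclic_of_total_maximal => // M M' _ _.
  exact: uniserial_total.
have [e|ne] := eqVneq (l - i)%N 0%N.
  apply: hleW (leq_maxl _ _) _; apply: hleW hV.
  by rewrite -subn_eq0 e.
apply/cyc_hle/cyclic_of_total_maximal => // M M' maxM maxM'.
have sr N : maximal_submod_of (full_submod V) N -> rad_iter V (l - i) `<=` N.
  move=> /rad_sub_maximal; apply: subset_trans; apply: (@rad_iter_sub _ _ 1).
  by rewrite lt0n.
exact: uniserial_quot_total uniQ (sr M maxM) (sr M' maxM').
Qed.

End FactorSerial.

(** * Artin algebras and the two implications *)

Section ArtinAlgebra.
Variables (R : comPzRingType) (L : algType R).
Hypothesis hL : artin_algebra L.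

(** Right ideals are [R]-submodules, so the [R]-length of [L] bounds its length as a right
    module. *)
Lemma artin_algebra_finlen : finlen (L^c)^o.
Proof.
have [artR fgL] := hL; have [n] := fin_gen_finlen (artinian_finlen artR) fgL.
(* The scalar [a] acts as right multiplication by [a *: 1], that is, as scaling over the converse
   ring. *)
have toRDZ (S : submodule (L^c)^o) a (u v : L) : S u -> S v -> S (a *: u + v).
  rewrite -[a *: u]mulr1 -scalerAl scalerAr.
  exact: (@submodDZ _ _ S (a *: 1) u v).
pose toR (S : submodule (L^c)^o) : submodule L :=
  @mk_submodule _ L (S : set L) (submod0 S) (toRDZ S).
move=> hn; exists n; have {hn} : hle n (toR (full_submod _)) by apply: hle_sub hn.
elim: n (full_submod _) => [|n IHn] S hS; first exact: hS.
by move=> T TS; apply/IHn/hS.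
Qed.

(** As [1] is nonzero in [L], the regular module has an indecomposable summand. This makes the set
    of factor serial indices nonempty. *)
Lemma artin_algebra_ex_indec : exists M : lmodType L^c, indec M.
Proof.
have [[|s l] sumL] := finlen_decomposable artin_algebra_finlen.
  by have := sumL 1; rewrite big_nil => /esym/eqP; rewrite (oner_eq0 L).
by exists (summand_obj s); apply: summand_indec.
Qed.

Lemma fin_gen_indec (M : lmodType L^c) : fin_gen M -> indecomposable M -> indec M.
Proof.
by move=> fgM indM; split=> //; apply: fin_gen_finlen artin_algebra_finlen fgM.
Qed.

Lemma representation_finite_Nakayama : representation_finite L ->
  exists n : nat, (0 < n)%N /\ right_Nakayama L n.
Proof.
move=> [m [F FP]].
have [b hb] : exists b, forall M : lmodType L^c, indec M -> hle b (full_submod M).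
  (* The bound for the class of [F i] is read off some indecomposable of finite length in it, and is
     [0] when there is none. *)
  have bd (i : 'I_m) : exists b, forall M : lmodType L^c, indec M -> isomorphic M (F i) ->
      hle b (full_submod M).
    have [[M [[[b hM] _] [f [g fK gK]]]]|nM] :=
        EM (exists M : lmodType L^c, indec M /\ isomorphic M (F i)); last first.
      by exists 0%N => M indM isoM; case: nM; exists M.
    exists b => N _ [f' [g' fK' gK']].
    apply: (hle_inj (can_inj fK')); apply: hle_sub (hle_surj (f := f) _ hM) => //.
    by move=> y; exists (g y).
  have [B hB] := choice bd; exists (\max_i B i) => M indM.
  have [||i isoM] := FP M; [by apply: finlen_fin_gen; case: indM | by case: indM | ].
  by apply: hleW (hB i M indM isoM); apply: leq_bigmax.
pose P i := (1 <= i <= b)%N && `[< exists M : lmodType L^c,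
  [/\ fin_gen M, indecomposable M & factor_serial i M] >].
have exP (M : lmodType L^c) : indec M -> exists2 i, P i & factor_serial i M.
  move=> indM; have [finM [nzM _]] := indM.
  have [l lenM] := ex_has_length finM.
  have [i /andP[i1 il] fsi] := ex_factor_serial nzM lenM; exists i => //.
  rewrite /P i1 (leq_trans il (has_length_le lenM (hb M indM))); apply/asboolP.
  by exists M; split=> //; [apply: finlen_fin_gen | case: indM].
have exPi : exists i, P i.
  by have [M /exP[i Pi _]] := artin_algebra_ex_indec; exists i.
have leP i : P i -> (i <= b)%N by case/andP => /andP[].
(* The largest index attained: being attained gives the existence clause, being largest the upper
   bound. *)
case: (ex_maxnP exPi leP) => n /andP[/andP[n1 _] /asboolP fsn] maxn.
exists n; split=> //; split=> // M fgM indM.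
have [i Pi fsi] := exP M (fin_gen_indec fgM indM); exists i => //.
by rewrite maxn // andbT; case/andP: Pi => /andP[].
Qed.

Lemma Nakayama_representation_finite n : right_Nakayama L n -> representation_finite L.
Proof.
move=> [nakL _]; have [c hc] := artin_algebra_finlen.
have hb (X : lmodType L^c) : indec X -> hle (maxn n c) (full_submod X).
  move=> [finX indX]; have [i /andP[_ le_in] fsi] := nakL X (finlen_fin_gen finX) indX.
  apply: hleW (factor_serial_hle hc fsi).
  by rewrite geq_max leq_maxr leq_max le_in.
have [l lP] := brauer_thrall hb artin_algebra_finlen.
pose M0 : lmodType L^c := (L^c)^o.
exists (size l), (fun i => nth M0 l i) => M fgM indM.
have /(has_nthP M0)[i lt_il /asboolP isoM] := lP M (fin_gen_indec fgM indM).
by exists (Ordinal lt_il).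
Qed.

End ArtinAlgebra.

Theorem theorem2p18 (R : comPzRingType) (L : algType R) (hL : artin_algebra L) :
  representation_finite L <-> exists n : nat, (0 < n)%N /\ right_Nakayama L n.
Proof.
split; first exact: representation_finite_Nakayama.
by move=> [n [_ /Nakayama_representation_finite]]; apply.
Qed.
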